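(* Let $(\mathbf X_n^I)_{n\ge1}$ be partially $\mathcal G$-c.i.d. with directing random measures $(\alpha_i)_{i\in I}$. Then $(\mathbf X_n^I)$ is asymptotically partially exchangeable with limit directing measures $(\alpha_i)_{i\in I}$: as $n\to\infty$, $(\mathbf X^I_{n+1},\mathbf X^I_{n+2},\dots)$ converges in distribution to $(\mathbf Z^I_1,\mathbf Z^I_2,\dots)$, where $[Z_{m,i}]_{m\ge1,i\in I}$ is a partially exchangeable array such that, conditionally on $(\alpha_i)_{i\in I}$, the $Z_{m,i}$ are independent with $Z_{m,i}$ having law $\alpha_i$.
   Context: All random elements live on $(\Omega,\mathcal F,\mathbb P)$; $\mathbb X$ is Polish with Borel $\sigma$-algebra $\mathcal X$; $I$ is a finite or countable index set; $[X_{n,i}]_{n\ge1,i\in I}$ is an array of $\mathbb X$-valued random variables with rows $\mathbf X_n^I=(X_{n,i})_{i\in I}$; convergence in distribution of sequences of rows refers to the product topology on $(\mathbb X^I)^{\mathbb N}$. For a filtration $\mathcal G=(\mathcal G_n)_{n\ge0}$ and $j\in I$, $\mathcal G_n^j=\mathcal G_n\vee\sigma(X_{n+1,i}:i\ne j)$. The process is partially $\mathcal G$-c.i.d. if it is adapted to $\mathcal G$ and $\mathbb E[f(X_{n+1,j})\mid\mathcal G_n^j]=\mathbb E[f(X_{n+k,j})\mid\mathcal G_n^j]$ a.s. for all $j\in I$, $k\ge1$, $n\ge0$ and bounded measurable $f$. In that case $\mathbb P[X_{n+1,i}\in\cdot\mid\mathcal G_n]$ converges weakly $\mathbb P$-a.s.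 to a random probability measure $\alpha_i$; $(\alpha_i)_{i\in I}$ are the directing random measures. An array is partially exchangeable if its law is invariant under separate finite permutations of each column. *)

(* Defs.v *)
From HB Require Import structures.
From mathcomp Require Import all_boot all_order all_algebra.
From mathcomp Require Import all_classical all_reals all_analysis measurable_realfun.
Set Implicit Arguments. Unset Strict Implicit. Unset Printing Implicit Defensive.
Import Order.TTheory GRing.Theory Num.Theory numFieldNormedType.Exports.
Local Open Scope classical_set_scope.
Local Open Scope ring_scope.

(** A Polish space, presented by a complete compatible (pseudo)metric:
    Hausdorff (so the pseudometric is a metric) and separable. *)
Definition polish {R : realType} (X : completePseudoMetricType R) : Prop :=
  hausdorff_space X /\ exists2 D : set X, countable D & dense D.

Definition borel (X : ptopologicalType) := g_sigma_algebraType (@open X).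

Definition measurable_wrt {d} {T : measurableType d} {U : Type}
  (H : set_system U) (f : U -> T) : Prop :=
  forall B : set T, measurable B -> H (f @^-1` B).

Definition is_filtration {d} {Omega : measurableType d}
  (G : nat -> set_system Omega) : Prop :=
  [/\ forall n, sigma_algebra setT (G n),
      forall n, G n `<=` measurable &
      forall n, G n `<=` G n.+1].

Definition cond_exp_version {d} {Omega : measurableType d} {R : realType}
  (P : probability Omega R) (H : set_system Omega) (f g : Omega -> R) : Prop :=
  [/\ measurable_wrt H g,
      P.-integrable setT (EFin \o g) &
      forall A, H A ->
        (\int[P]_(x in A) (g x)%:E = \int[P]_(x in A) (f x)%:E)%E].

Definition bounded_measurable {R : realType} (X : completePseudoMetricType R)
  (f : X -> R) : Prop :=
  measurable_fun [set: borel X] (f : borel X -> R) /\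
  exists M : R, forall x, `|f x| <= M.

(** G_n^j = G_n \/ sigma(X_{n+1,i} : i <> j).  Rows are indexed from 1:
    [X n i] is X_{n,i} for n >= 1 ([X 0] is unused). *)
Definition Gnj {d} {Omega : measurableType d} {R : realType} {I : countType}
  {Xs : completePseudoMetricType R}
  (G : nat -> set_system Omega) (X : nat -> I -> Omega -> borel Xs)
  (n : nat) (j : I) : set_system Omega :=
  <<s G n `|` [set A | exists i (B : set (borel Xs)),
                  [/\ i != j, measurable B & A = X n.+1 i @^-1` B]] >>.

Definition partially_cid {d} {Omega : measurableType d} {R : realType}
  {I : countType} {Xs : completePseudoMetricType R}
  (P : probability Omega R) (G : nat -> set_system Omega)
  (X : nat -> I -> Omega -> borel Xs) : Prop :=
  [/\ is_filtration G,
      (forall n i, (1 <= n)%N -> measurable_wrt (G n) (X n i)) &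
      forall (j : I) (n k : nat), (1 <= k)%N ->
      forall f : Xs -> R, bounded_measurable f ->
      forall g1 g2 : Omega -> R,
        cond_exp_version P (Gnj G X n j) (f \o X n.+1 j) g1 ->
        cond_exp_version P (Gnj G X n j) (f \o X (n + k)%N j) g2 ->
        {ae P, forall w, g1 w = g2 w}].

Definition weak_cvg {R : realType} {Xs : completePseudoMetricType R}
  (mu : nat -> probability (borel Xs) R) (nu : probability (borel Xs) R) : Prop :=
  forall h : Xs -> R, continuous h -> (exists M : R, forall x, `|h x| <= M) ->
    ((fun n => \int[mu n]_x (h x)%:E) @ \oo --> \int[nu]_x (h x)%:E)%E.

Definition directing_measures {d} {Omega : measurableType d} {R : realType}
  {I : countType} {Xs : completePseudoMetricType R}
  (P : probability Omega R) (G : nat -> set_system Omega)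
  (X : nat -> I -> Omega -> borel Xs)
  (alpha : I -> Omega -> probability (borel Xs) R) : Prop :=
  (forall i (B : set (borel Xs)), measurable B ->
      measurable_fun [set: Omega] (fun w => alpha i w B)) /\
  forall i, exists kappa : nat -> Omega -> probability (borel Xs) R,
    (forall n (B : set (borel Xs)), measurable B ->
       cond_exp_version P (G n) (\1_(X n.+1 i @^-1` B))
                        (fun w => fine (kappa n w B))) /\
    {ae P, forall w, weak_cvg (fun n => kappa n w) (alpha i w)}.

Definition array_sigma {R : realType} {I : countType}
  {Xs : completePseudoMetricType R} : set_system (nat -> I -> Xs) :=
  <<s [set A | exists m i (B : set (borel Xs)),
          measurable B /\ A = [set z | B (z m i)]] >>.

Definition fin_perm (s : nat -> nat) : Prop :=
  bijective s /\ exists N, forall m, (N <= m)%N -> s m = m.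

(** Partially exchangeable array: law invariant under separate finite
    permutations of each column.  [Z m i] is Z_{m+1,i}. *)
Definition partially_exchangeable {d} {Omega : measurableType d}
  {R : realType} {I : countType} {Xs : completePseudoMetricType R}
  (P : probability Omega R) (Z : nat -> I -> Omega -> borel Xs) : Prop :=
  forall sg : I -> nat -> nat, (forall i, fin_perm (sg i)) ->
  forall A, array_sigma A ->
    P [set w | A (fun m i => Z m i w)] = P [set w | A (fun m i => Z (sg i m) i w)].

Definition sigma_rm {d} {Omega : measurableType d} {R : realType}
  {I : countType} {Xs : completePseudoMetricType R}
  (beta : I -> Omega -> probability (borel Xs) R) : set_system Omega :=
  <<s [set A | exists i (B : set (borel Xs)) (C : set (\bar R)),
          [/\ measurable B, measurable C &
              A = (fun w => beta i w B) @^-1` C]] >>.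

Definition cond_indep_laws {d} {Omega : measurableType d} {R : realType}
  {I : countType} {Xs : completePseudoMetricType R}
  (P : probability Omega R) (Z : nat -> I -> Omega -> borel Xs)
  (beta : I -> Omega -> probability (borel Xs) R) : Prop :=
  forall (s : seq (nat * I)) (B : nat -> I -> set (borel Xs)),
    uniq s -> (forall m i, measurable (B m i)) ->
    cond_exp_version P (sigma_rm beta)
      (\1_([set w | forall p, p \in s -> B p.1 p.2 (Z p.1 p.2 w)]))
      (fun w => \prod_(p <- s) fine (beta p.2 w (B p.1 p.2))).

Definition cvg_in_distribution {d d'} {Omega : measurableType d}
  {Omega' : measurableType d'} {R : realType} {I : countType}
  {Xs : completePseudoMetricType R}
  (P : probability Omega R) (Y : nat -> Omega -> nat -> I -> Xs)
  (P' : probability Omega' R) (Z : Omega' -> nat -> I -> Xs) : Prop :=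
  forall g : {ptws nat -> {ptws I -> Xs}} -> R,
    (forall x : {ptws nat -> {ptws I -> Xs}}, g y @[y --> x] --> g x) ->
    (exists M : R, forall x, `|g x| <= M) ->
    ((fun n => \int[P]_w (g (Y n w))%:E) @ \oo --> \int[P']_w (g (Z w))%:E)%E.

(* Main.v *)
(* Tested against the past and the other entries of row n+1, the c.i.d. property
   lets one replace f(X_{n+1,j}) by f(X_{n+k,j}) and, letting k go to infinity
   through the predictive measures, by the integral of f against alpha_j.
   Removing the entries of a finite block one at a time, latest first, gives
   the convergence of the expectations of finite products of continuous
   functions of X_{n+m,i} to those of products of alpha_i-integrals.  Indicators
   of open sets of arrays are increasing limits of functions 1 - prod (1 - h_j)
   with h_j such products, so the layer-cake formula extends the convergence to
   all bounded continuous functions, as in the portmanteau theorem.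

   The limit array lives on Omega x [0, 1[: a Polish space embeds measurably,
   with a measurable retraction, in the space of binary sequences, and the
   product of the kernels alpha_i becomes a kernel into binary sequences, which
   is realised by cutting [0, 1[ into intervals of prescribed lengths. *)
Require Import Defs.
From HB Require Import structures.
From mathcomp Require Import all_boot all_order all_algebra.
From mathcomp Require Import all_classical all_reals all_analysis measurable_realfun.
From mathcomp Require Import lra.
Set Implicit Arguments. Unset Strict Implicit. Unset Printing Implicit Defensive.
Import Order.TTheory GRing.Theory Num.Theory numFieldNormedType.Exports.
Local Open Scope classical_set_scope.
Local Open Scope ring_scope.

(** * Random binary sequences with prescribed law *)

(** The alpha_j-integral that replaces the latest entry of a block is not known to be measurable for
    the past, so it cannot stay beside the earlier entries when the next one is removed. It is
    exchanged for the predictive mean at the time n preceding the block, at an L1 cost tending to 0;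
    for this reason the induction is stated with arbitrary [G n]-measurable weights. Entries of a
    common row cause no trouble, because the c.i.d. property conditions on the other entries of the
    row. No tightness argument occurs: the limit is built independently of the convergence. Building
    it on an extension of [Omega] lets the given alpha_i themselves, and not a copy, direct it; the
    added uniform variable is independent of [Omega], so the joint law with every event of [Omega]
    is explicit, and conditioning on the alpha_i follows. Only lower bounds on expectations are
    approximated; the upper ones come from [1 - g]. *)

Lemma image_measure (R : realType) d1 d2 (T1 : measurableType d1)
  (T2 : measurableType d2) (f : T1 -> T2) :
  measurable_fun setT f -> forall m : {measure set T1 -> \bar R},
  exists m' : {measure set T2 -> \bar R}, forall A, m' A = m (f @^-1` A).
Proof. by move=> mf m; unshelve eexists (pushforward m f). Qed.

(** A list may constrain a bit twice, even inconsistently, so that intersecting cylinders is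
    concatenating lists and no empty case has to be singled out. *)
Definition bit_cyl (l : seq (nat * bool)) : set (nat -> bool) :=
  [set s | forall p, p \in l -> s p.1 = p.2].

Definition bits := g_sigma_algebraType (range bit_cyl).

Lemma bit_cyl0 : bit_cyl [::] = setT.
Proof. by apply/seteqP; split. Qed.

Lemma bit_cyl_cat l1 l2 : bit_cyl (l1 ++ l2) = bit_cyl l1 `&` bit_cyl l2.
Proof.
apply/seteqP; split => [s sl|s [sl1 sl2] p].
  by split=> p pl; apply: sl; rewrite mem_cat pl ?orbT.
by rewrite mem_cat => /orP[/sl1|/sl2].
Qed.

Lemma measurable_bit_cyl l : measurable (bit_cyl l : set bits).
Proof. by apply: sub_sigma_algebra; exists l. Qed.

Lemma bit_cyl_preimage (T : Type) (f : T -> nat -> bool) l :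
  f @^-1` bit_cyl l = \big[setI/setT]_(p <- l) [set t | f t p.1 = p.2].
Proof.
elim: l => [|p l IHl]; first by rewrite big_nil bit_cyl0 preimage_setT.
rewrite big_cons -IHl; apply/seteqP; split => [t tl|t [tp tl] q].
  split; first exact: tl (mem_head _ _).
  by move=> q ql; apply: tl; rewrite inE ql orbT.
by rewrite inE => /orP[/eqP ->|/tl].
Qed.

Lemma measurable_fun_bits d (T : measurableType d) (f : T -> bits) :
  (forall n, measurable [set t | f t n]) -> measurable_fun setT f.
Proof.
move=> mf; apply: (@measurability _ _ _ _ setT f (range bit_cyl)) => //.
move=> _ [_ [l _ <-] <-]; rewrite setTI bit_cyl_preimage.
elim: l => [|p l IHl]; first by rewrite big_nil.
rewrite big_cons; apply: measurableI => //; case: p => n [] /=; first exact: mf.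
rewrite (_ : [set t | _] = ~` [set t | f t n]); first exact: measurableC.
by apply/seteqP; split => t /=; case: (f t n).
Qed.

Lemma measurable_bit d (T : measurableType d) (f : T -> bits) n :
  measurable_fun setT f -> measurable [set t | f t n].
Proof.
move=> mf; have := mf measurableT _ (measurable_bit_cyl [:: (n, true)]).
by rewrite setTI bit_cyl_preimage big_seq1.
Qed.

Lemma bits_measure_unique (R : realType) (m1 m2 : {measure set bits -> \bar R}) :
  (forall l, m1 (bit_cyl l) = m2 (bit_cyl l)) -> (m1 setT < +oo)%E ->
  forall A, measurable A -> m1 A = m2 A.
Proof.
move=> m12 m1fin A mA.
apply: (@measure_unique _ R bits (range bit_cyl) (fun=> setT) _ _ _ _ m1 m2) => //.
- by move=> _ _ [l1 _ <-] [l2 _ <-]; exists (l1 ++ l2); rewrite // bit_cyl_cat.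
- by move=> _; exists [::]; rewrite // bit_cyl0.
- by rewrite bigcup_const//; exists 0%N.
- by move=> _ [l _ <-].
Qed.

(** A left inverse that is measurable on all binary sequences avoids any description of the image of
    [b]: laws on [T] go to [bits] through [b], random bits come back through [D]. *)
Definition coded d (T : measurableType d) : Prop :=
  exists (b : T -> bits) (D : bits -> T),
    [/\ measurable_fun setT b, measurable_fun setT D & cancel b D].

(** * Digits of a point read off nested intervals *)

Section interval_digits.
Context {R : realType} (m : seq bool -> R).
Hypothesis m_ge0 : forall p, 0 <= m p.
Hypothesis m_nil : m [::] = 1.
Hypothesis m_rcons : forall p, m p = m (rcons p false) + m (rcons p true).

(* The intervals [lo p, lo p + m p[ of the prefixes p of a given length
   partition [0, 1[ in lexicographic order. *)
Definition lo (p : seq bool) : R :=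
  \sum_(k < size p | nth false p k) m (rcons (take k p) false).

Fixpoint prefix_at (u : R) n : seq bool :=
  if n is k.+1 then
    let p := prefix_at u k in rcons p (lo p + m (rcons p false) <= u)
  else [::].

Definition digit (u : R) n : bool :=
  lo (prefix_at u n) + m (rcons (prefix_at u n) false) <= u.

Lemma prefix_at_mkseq u n : prefix_at u n = mkseq (digit u) n.
Proof. by elim: n => //= n IHn; rewrite mkseqS -IHn. Qed.

Lemma lo_nil : lo [::] = 0.
Proof. by rewrite /lo big_ord0. Qed.

Lemma lo_rcons p v : lo (rcons p v) = lo p + (if v then m (rcons p false) else 0).
Proof.
rewrite /lo size_rcons big_mkcond big_ord_recr /= nth_rcons ltnn eqxx.
rewrite -cats1 take_size_cat//; congr (_ + _).
rewrite [RHS]big_mkcond /=; apply: eq_bigr => k _.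
by rewrite nth_cat ltn_ord takel_cat// ltnW.
Qed.

Lemma lo_bounds p : 0 <= lo p /\ lo p + m p <= 1.
Proof.
elim/last_ind: p => [|p v [p0 p1]]; first by rewrite lo_nil m_nil add0r.
have := m_rcons p; have := m_ge0 (rcons p false); have := m_ge0 (rcons p true).
by rewrite lo_rcons; case: v => ? ? ?; lra.
Qed.

(** The half-open intervals of the two extensions of a prefix split its interval. Null masses need
    no separate case: they give empty intervals, hence prefixes that no point has. *)
Lemma prefix_atP u n p : 0 <= u < 1 -> size p = n ->
  prefix_at u n = p <-> lo p <= u < lo p + m p.
Proof.
move=> u01; elim: n p => [|n IHn] p.
  by move/size0nil ->; rewrite lo_nil m_nil add0r; split.
case/lastP: p => // p v; rewrite size_rcons => -[sp] /=.
have H0 := m_ge0 (rcons p false); have H1 := m_ge0 (rcons p true).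
have Hm := m_rcons p; rewrite lo_rcons.
split.
  move=> /rcons_inj[/[dup] pE /(IHn _ sp) /andP[ple ltp]]; rewrite pE => <-.
  by case: (leP (lo p + m (rcons p false)) u) => ?; apply/andP; split; lra.
move=> /andP[le1 lt1].
have /(IHn _ sp) -> : lo p <= u < lo p + m p.
  by move: le1 lt1; case: v => ? ?; apply/andP; split; lra.
congr rcons; move: le1 lt1.
by case: v => ? ?; case: (leP (lo p + m (rcons p false)) u) => //; lra.
Qed.

End interval_digits.

Lemma uniform_prob_itv (R : realType) (a b : R) : 0 <= a -> a <= b -> b <= 1 ->
  uniform_prob (@ltr01 R) [set` `[a, b[] = (b - a)%:E.
Proof.
move=> a0 ab b1; rewrite /uniform_prob integral_uniform_pdf.
rewrite setIidl; last first.
  move=> x /=; rewrite !in_itv/= => /andP[ax xb].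
  by rewrite (le_trans a0 ax) (le_trans (ltW xb) b1).
rewrite (eq_integral (fun=> 1%E)); last first.
  move=> x; rewrite inE/= in_itv/= => /andP[ax xb].
  rewrite /uniform_pdf (le_trans a0 ax) (le_trans (ltW xb) b1)/=.
  by rewrite subr0 invr1.
rewrite integral_cst//= mul1e lebesgue_measure_itv/= lte_fin.
by move: ab; rewrite le_eqVlt => /orP[/eqP ->|->]; rewrite ?ltxx ?subrr.
Qed.

(** The intervals of the prefixes cover only the half-open unit interval; its complement is null for
    the uniform law. *)
Lemma uniform_prob01 (R : realType) (A : set (measurableTypeR R)) :
  measurable A ->
  uniform_prob (@ltr01 R) A = uniform_prob (@ltr01 R) (A `&` [set` `[0, 1[]).
Proof.
move=> mA.
have U01 : uniform_prob (@ltr01 R) [set` `[0, 1[] = 1%E.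
  by rewrite uniform_prob_itv// subr0.
have mI : measurable ([set` `[0%R, 1%R[] : set (measurableTypeR R)) by [].
have -> : A = (A `&` [set` `[0, 1[]) `|` (A `\` [set` `[0, 1[]).
  by rewrite setUIDK.
rewrite measureU//; last 3 first.
- exact: measurableI.
- exact: measurableD.
- by rewrite setDE setIACA setICr setI0.
rewrite (_ : (A `&` _ `|` _) = A) ?setUIDK//.
rewrite [X in (_ + X)%E](_ : _ = 0%E) ?adde0//.
apply/eqP; rewrite eq_le measure_ge0 andbT.
have <- : uniform_prob (@ltr01 R) (~` [set` `[0, 1[]) = 0%E.
    by rewrite probability_setC// [X in (_ - X)%E](_ : _ = 1%E)// subee.
apply: (@le_measure _ _ _ (uniform_prob (@ltr01 R))); rewrite ?inE.
- exact: measurableD.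
- exact: measurableC.
- by move=> x [].
Qed.
(** Joint measurability is what will make the limit array measurable on the product space. The
    threshold of a digit depends on the prefix already read, but there are countably many prefixes,
    and for a fixed one [u] is compared with a measurable function of [w]. *)
Lemma measurable_digit (R : realType) d (W : measurableType d)
  (m : W -> seq bool -> R) n :
  (forall p, measurable_fun setT (fun w => m w p)) ->
  measurable [set wu : W * measurableTypeR R | digit (m wu.1) wu.2 n].
Proof.
move=> mm.
have mlo p : measurable_fun [set: W * measurableTypeR R]
    (fun wu => lo (m wu.1) p + m wu.1 (rcons p false)).
  apply: measurable_funD; last exact: (measurableT_comp (mm _) measurable_fst).
  rewrite /lo; under eq_fun do rewrite big_mkcond /=.
  apply: measurable_sum => k; case: (nth false p k) => //.
  exact: (measurableT_comp (mm _) measurable_fst).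
have mle p : measurable [set wu : W * measurableTypeR R |
    lo (m wu.1) p + m wu.1 (rcons p false) <= wu.2].
  rewrite -[X in measurable X]setTI.
  exact: (measurable_fun_ler (mlo p) measurable_snd measurableT (Y := [set true])).
have mprefix k p :
    measurable [set wu : W * measurableTypeR R | prefix_at (m wu.1) wu.2 k = p].
  elim: k p => [|k IHk] p.
    rewrite /=; have [->|np] := eqVneq p [::].
      by rewrite (_ : [set _ | _] = setT)//; apply/seteqP; split.
    rewrite (_ : [set _ | _] = set0)//; apply/seteqP; split => // wu /= /esym.
    by move/eqP; rewrite (negbTE np).
  case/lastP: p => [|p v].
    rewrite (_ : [set _ | _] = set0)//; apply/seteqP; split => // wu /=.
    by move/(congr1 size); rewrite size_rcons.
  rewrite (_ : [set _ | _] = [set wu | prefix_at (m wu.1) wu.2 k = p] `&`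
    (if v then [set wu | lo (m wu.1) p + m wu.1 (rcons p false) <= wu.2]
     else ~` [set wu | lo (m wu.1) p + m wu.1 (rcons p false) <= wu.2])).
    by apply: measurableI => //; case: v => //; exact: measurableC.
  apply/seteqP; split => wu /=.
    move=> /rcons_inj[-> vE]; split => //.
    by case: v vE => /= [->//|vE]; rewrite vE.
  by move=> [->]; case: v => /= [->//|/negP/negbTE ->].
rewrite (_ : [set _ | _] = \bigcup_p
  ([set wu | prefix_at (m wu.1) wu.2 n = p] `&`
   [set wu | lo (m wu.1) p + m wu.1 (rcons p false) <= wu.2])).
  by apply: countable_bigcupT_measurable => // p; exact: measurableI.
apply/seteqP; split => [wu nwu|wu [p _ [<-]]//].
by exists (prefix_at (m wu.1) wu.2 n).
Qed.

(** * Products of sequences of kernels as laws on binary sequences *)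

Section product_digits.
Context {R : realType} {d} {T : measurableType d} {dW} {W : measurableType dW}.
Variables (b : T -> bits) (mu : nat -> W -> probability T R).
Variables (coord index : nat -> nat).
Hypothesis mb : measurable_fun setT b.
Hypothesis mmu : forall q B, measurable B ->
  measurable_fun setT (fun w => mu q w B).

(* Digit number [k] of the random sequence will be bit number [index k] of the
   coordinate number [coord k]. *)
Definition factor_set (l : seq (nat * bool)) (q : nat) : set T :=
  [set x | forall p, p \in l -> coord p.1 = q -> b x (index p.1) = p.2].

Lemma factor_setE l q : factor_set l q =
  b @^-1` bit_cyl [seq (index p.1, p.2) | p <- l & coord p.1 == q].
Proof.
apply/seteqP; split => [x lx _ /mapP[p + ->]|x lx p pl pq].
  by rewrite mem_filter => /andP[/eqP pq pl] /=; exact: lx.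
apply: (lx (index p.1, p.2)); apply/mapP; exists p => //.
by rewrite mem_filter pq eqxx.
Qed.

Lemma measurable_factor_set l q : measurable (factor_set l q).
Proof.
by rewrite factor_setE -[X in measurable X]setTI; apply: mb => //;
   exact: measurable_bit_cyl.
Qed.

Definition factor w l q : R := fine (mu q w (factor_set l q)).

Lemma factorE w l q : (factor w l q)%:E = mu q w (factor_set l q).
Proof. by rewrite fineK// fin_num_measure//; exact: measurable_factor_set. Qed.

Lemma factor_ge0 w l q : 0 <= factor w l q.
Proof. exact/fine_ge0/measure_ge0. Qed.

Lemma factor_id w l q : (forall p, p \in l -> coord p.1 != q) -> factor w l q = 1.
Proof.
move=> lq; rewrite /factor (_ : factor_set l q = setT) ?probability_setT//.
by apply/seteqP; split => // x _ p /lq /eqP.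
Qed.

Lemma factor_cons_neq w k v l q : coord k != q -> factor w ((k, v) :: l) q = factor w l q.
Proof.
move=> kq; congr (fine (mu q w _)); apply/seteqP; split => x lx p pl pq.
  by apply: lx => //; rewrite inE pl orbT.
by move: pl pq; rewrite inE => /orP[/eqP -> /= /eqP|/lx]//; rewrite (negbTE kq).
Qed.

Lemma factor_split w k l :
  factor w l (coord k) =
  factor w ((k, false) :: l) (coord k) + factor w ((k, true) :: l) (coord k).
Proof.
apply: EFin_inj; rewrite EFinD !factorE -measureU; last 3 first.
- exact: measurable_factor_set.
- exact: measurable_factor_set.
- apply/seteqP; split => // x [fx tx].
  have := fx _ (mem_head _ _) erefl; have := tx _ (mem_head _ _) erefl.
  by move=> /= ->.
congr (mu _ _ _); apply/seteqP; split => x.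
  move=> lx; case E : (b x (index k)); [right|left] => p;
    by rewrite inE => /orP[/eqP ->//|/lx].
by move=> [] lx p pl pq; apply: lx => //; rewrite inE pl orbT.
Qed.

(** The mass of the cylinder of [l] under the product of the kernels. [Q] bounds the coordinates
    that [l] mentions; the factors beyond would be 1. *)
Definition cyl_mass w Q l : R := \prod_(q < Q) factor w l q.

Lemma cyl_mass_eq_mem w Q l l' : l =i l' -> cyl_mass w Q l = cyl_mass w Q l'.
Proof.
move=> ll'; apply: eq_bigr => q _; congr (fine (mu _ _ _)).
by apply/seteqP; split => x lx p pl; apply: lx; rewrite ?ll'// -ll'.
Qed.

(** Bit [k] is seen by the factor of [coord k] alone, so additivity of that one measure is
    enough. *)
Lemma cyl_mass_split w Q k l : (coord k < Q)%N ->
  cyl_mass w Q l = cyl_mass w Q ((k, false) :: l) + cyl_mass w Q ((k, true) :: l).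
Proof.
move=> kQ; rewrite /cyl_mass (bigD1 (Ordinal kQ))//= (factor_split w k l) mulrDl.
rewrite [in RHS](bigD1 (Ordinal kQ))//= [X in _ = _ + X](bigD1 (Ordinal kQ))//=.
congr (_ * _ + _ * _); apply: eq_bigr => q; rewrite -val_eqE/= eq_sym => kq;
  by rewrite factor_cons_neq.
Qed.

Lemma cyl_mass_widen w Q Q' l : (forall p, p \in l -> (coord p.1 < Q)%N) ->
  (Q <= Q')%N -> cyl_mass w Q l = cyl_mass w Q' l.
Proof.
move=> lQ QQ'; rewrite /cyl_mass (big_ord_widen _ (factor w l) QQ') big_mkcond/=.
apply: eq_bigr => q _; case: ltnP => // Qq; rewrite factor_id// => p /lQ pQ.
by rewrite neq_ltn (leq_trans pQ Qq).
Qed.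

Definition prefix_cyl (p : seq bool) : seq (nat * bool) :=
  mkseq (fun k => (k, nth false p k)) (size p).

Lemma prefix_cyl_rcons p v :
  prefix_cyl (rcons p v) = rcons (prefix_cyl p) (size p, v).
Proof.
rewrite /prefix_cyl size_rcons mkseqS nth_rcons ltnn eqxx; congr rcons.
apply/eq_in_map => k; rewrite mem_iota add0n => /andP[_ kp].
by rewrite nth_rcons kp.
Qed.

Lemma mem_prefix_cyl p kv :
  (kv \in prefix_cyl p) = (kv.1 < size p)%N && (kv.2 == nth false p kv.1).
Proof.
apply/mapP/andP => [[k + ->]|[kp /eqP vE]].
  by rewrite mem_iota add0n => /andP[_ kp] /=; split.
by exists kv.1; rewrite ?mem_iota//; case: kv kp vE => k v /= _ ->.
Qed.

Lemma prefix_cylP (s : nat -> bool) p :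
  bit_cyl (prefix_cyl p) s <-> mkseq s (size p) = p.
Proof.
split=> [sp|<- kv].
  apply: (@eq_from_nth _ false); rewrite size_mkseq// => k kp.
  by rewrite nth_mkseq//; apply: (sp (k, _)); rewrite mem_prefix_cyl kp/=.
rewrite mem_prefix_cyl size_mkseq => /andP[kp /eqP ->].
by rewrite nth_mkseq.
Qed.

Definition coord_bound n := \max_(k < n) (coord k).+1.

Lemma coord_boundP n k : (k < n)%N -> (coord k < coord_bound n)%N.
Proof. by move=> kn; exact: (leq_bigmax (Ordinal kn)). Qed.

(** These are the interval lengths given to [digit]. The bound on the coordinates grows with the
    prefix, hence the appeals to [cyl_mass_widen]. *)
Definition prefix_mass w (p : seq bool) : R :=
  cyl_mass w (coord_bound (size p)) (prefix_cyl p).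

Lemma prefix_mass_ge0 w p : 0 <= prefix_mass w p.
Proof. by apply: prodr_ge0 => q _; exact: factor_ge0. Qed.

Lemma prefix_mass_nil w : prefix_mass w [::] = 1.
Proof. by rewrite /prefix_mass /coord_bound big_ord0 /cyl_mass big_ord0. Qed.

Lemma prefix_massE w p Q : (coord_bound (size p) <= Q)%N ->
  prefix_mass w p = cyl_mass w Q (prefix_cyl p).
Proof.
move=> pQ; apply: cyl_mass_widen => // kv; rewrite mem_prefix_cyl => /andP[kp _].
exact: coord_boundP.
Qed.

Lemma prefix_mass_rcons w p :
  prefix_mass w p = prefix_mass w (rcons p false) + prefix_mass w (rcons p true).
Proof.
have le : (coord_bound (size p) <= coord_bound (size p).+1)%N.
  by rewrite /coord_bound big_ord_recr leq_maxl.
rewrite (prefix_massE _ le) (@cyl_mass_split _ _ (size p)); last exact: coord_boundP.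
congr (_ + _); rewrite /prefix_mass size_rcons prefix_cyl_rcons;
  by apply: cyl_mass_eq_mem => kv; rewrite mem_rcons.
Qed.

Lemma measurable_prefix_mass p : measurable_fun setT (fun w => prefix_mass w p).
Proof.
rewrite /prefix_mass /cyl_mass; apply: measurable_prod => q _.
rewrite /factor; apply: (measurableT_comp (fine_measurable measurableT)).
by apply: mmu; exact: measurable_factor_set.
Qed.

Local Notation N w u := (digit (prefix_mass w) u).
Local Notation lam := (uniform_prob (@ltr01 R)).

Lemma measurable_product_digit n :
  measurable [set wu : W * measurableTypeR R | N wu.1 wu.2 n].
Proof. exact: measurable_digit measurable_prefix_mass. Qed.

Lemma measurable_product_digits w :
  measurable_fun [set: measurableTypeR R] (fun u => N w u : bits).
Proof.
apply: measurable_fun_bits => n.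
have := measurable_xsection w (measurable_product_digit n).
by rewrite (_ : xsection _ _ = [set u | N w u n])//;
   apply/seteqP; split => u; rewrite /xsection/= inE.
Qed.

(** The interval construction controls full prefixes, whereas [l] constrains scattered bits. Both
    sides are therefore split along all the prefixes of a length that decides every constraint of
    [l]. *)
Lemma product_digit_law w Q l : (forall p, p \in l -> (coord p.1 < Q)%N) ->
  lam [set u | bit_cyl l (N w u)] = (cyl_mass w Q l)%:E.
Proof.
move=> lQ.
have mcyl l' : measurable ([set u | bit_cyl l' (N w u)] : set (measurableTypeR R)).
  have := measurable_product_digits w measurableT (measurable_bit_cyl l').
  by rewrite setTI.
pose K := \max_(p <- l) p.1.+1.
have lK p : p \in l -> (p.1 < K)%N by move=> pl; exact: (@leq_bigmax_seq _ _ xpredT (fun q => q.1.+1)).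
(* Large enough both for [l] and for the first [K] digits. *)
pose Q' := maxn Q (coord_bound K).
rewrite (@cyl_mass_widen _ _ Q')// ?leq_maxl//.
suff H j p : (size p + j = K)%N ->
    lam [set u | bit_cyl (l ++ prefix_cyl p) (N w u)] =
    (cyl_mass w Q' (l ++ prefix_cyl p))%:E.
  by have := H K [::] erefl; rewrite cats0.
elim: j p => [|j IHj] p pK.
  rewrite addn0 in pK.
  (* A prefix of length [K] decides [l]. If it agrees with [l], the event is the interval of [p];
     otherwise both sides vanish. *)
  have [/allP lp|] := boolP (all (fun kv => kv.2 == nth false p kv.1) l).
    have lpE : l ++ prefix_cyl p =i prefix_cyl p.
      move=> kv; rewrite mem_cat; case: (boolP (kv \in l)) => //= kvl.
      by rewrite mem_prefix_cyl pK lK// (lp _ kvl).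
    rewrite (cyl_mass_eq_mem w Q' lpE) -prefix_massE ?pK ?leq_maxr//.
    rewrite uniform_prob01//.
    have [lo0 lo1] := lo_bounds (prefix_mass_ge0 w) (prefix_mass_nil w) (prefix_mass_rcons w) p.
    have := prefix_mass_ge0 w p.
    rewrite (_ : _ `&` _ = [set` `[lo (prefix_mass w) p, lo (prefix_mass w) p + prefix_mass w p[]).
      by move=> ?; rewrite uniform_prob_itv//; [congr EFin; lra|lra].
    have cylE u : bit_cyl (l ++ prefix_cyl p) (N w u) <-> prefix_at (prefix_mass w) u K = p.
      rewrite prefix_at_mkseq -{1}pK -prefix_cylP.
      by split=> lpu kv; [rewrite -lpE => /lpu|rewrite lpE => /lpu].
    have PP u := @prefix_atP _ _ (prefix_mass_ge0 w) (prefix_mass_nil w)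
      (prefix_mass_rcons w) u K p.
    apply/seteqP; split => u /=; rewrite !in_itv/=.
      by move=> [/cylE up u01]; apply/PP.
    move=> uI; have u01 : 0 <= u < 1.
      by move: uI => /andP[? ?]; apply/andP; split; lra.
    by split => //; apply/cylE; apply/(PP _ u01 pK).
  (* Bit [k] gets two opposite constraints: the event is empty, and so is the set measured by the
     factor of [coord k]. *)
  move=> /allPn[[k v] kvl /= vp].
  rewrite (_ : [set u | _] = set0); last first.
    apply/seteqP; split => // u /= ul.
    have := ul (k, v); have := ul (k, nth false p k).
    rewrite !mem_cat kvl mem_prefix_cyl /= eqxx pK (lK _ kvl) orbT => -> // /(_ isT) /eqP.
    by rewrite eq_sym (negbTE vp).
  rewrite measure0; congr EFin; apply/esym/eqP.
  have kQ : (coord k < Q')%N by rewrite (leq_trans (lQ _ kvl))// leq_maxl.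
  rewrite /cyl_mass (bigD1 (Ordinal kQ))//= /factor (_ : factor_set _ _ = set0) ?measure0 ?mul0r//.
  apply/seteqP; split => // x xl.
  have := xl (k, v); have := xl (k, nth false p k).
  rewrite !mem_cat kvl mem_prefix_cyl /= eqxx pK (lK _ kvl) orbT.
  by move=> /(_ isT erefl) -> /(_ isT erefl) /eqP; rewrite eq_sym (negbTE vp).
have E v : (size p, v) :: l ++ prefix_cyl p =i l ++ prefix_cyl (rcons p v).
  move=> kv; rewrite prefix_cyl_rcons inE !mem_cat mem_rcons inE.
  by rewrite orbCA.
rewrite (@cyl_mass_split _ _ (size p)); last first.
  apply: leq_trans (leq_maxr _ _); apply: coord_boundP.
  by rewrite -pK addnS ltnS leq_addr.
rewrite !(cyl_mass_eq_mem w Q' (E _)) EFinD -!IHj ?size_rcons ?addSnnS//.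
rewrite -measureU//.
  congr (lam _); apply/seteqP; split => u.
    move=> lu; case Nu : (N w u (size p)); [right|left] => kv;
      by rewrite -E inE => /orP[/eqP ->//|/lu].
  by move=> [] lu kv kvl; apply: lu; rewrite -E inE kvl orbT.
apply/seteqP; split => // u [/(_ (size p, false)) + /(_ (size p, true))].
by rewrite -!E !mem_head => -> // /(_ isT).
Qed.

Lemma cyl_mass_cat w Q q l1 l2 : (q < Q)%N ->
  (forall p, p \in l1 -> coord p.1 = q) -> (forall p, p \in l2 -> coord p.1 != q) ->
  cyl_mass w Q (l1 ++ l2) = factor w l1 q * cyl_mass w Q l2.
Proof.
move=> qQ l1q l2q; rewrite /cyl_mass (bigD1 (Ordinal qQ))//=.
rewrite [in RHS](bigD1 (Ordinal qQ))//= [factor w l2 q]factor_id// mul1r.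
congr (_ * _).
  rewrite /factor !factor_setE filter_cat [seq.filter _ l2](_ : _ = [::]) ?cats0//.
  by apply/eqP; rewrite -(negbK (_ == _)) -has_filter; apply/hasPn => p /l2q.
apply: eq_bigr => q'; rewrite -val_eqE/= => q'q.
rewrite /factor !factor_setE filter_cat [seq.filter _ l1](_ : _ = [::])//.
apply/eqP; rewrite -(negbK (_ == _)) -has_filter; apply/hasPn => p /l1q ->.
by rewrite eq_sym.
Qed.

(* Coordinates in [s] carry arbitrary events, the others only cylinders: the
   coordinates are moved from the second kind to the first one at a time. *)
Lemma product_digit_indep (D : bits -> T) w Q (place : nat -> nat -> nat)
    (s : seq nat) (B : nat -> set T) l :
  measurable_fun setT D -> cancel b D ->
  (forall q n, coord (place q n) = q) -> (forall q n, index (place q n) = n) ->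
  uniq s -> (forall q, measurable (B q)) ->
  (forall q, q \in s -> (q < Q)%N) -> (forall p, p \in l -> (coord p.1 < Q)%N) ->
  (forall p, p \in l -> coord p.1 \notin s) ->
  lam ([set u | forall q, q \in s -> B q (D (fun n => N w u (place q n)))] `&`
       [set u | bit_cyl l (N w u)]) =
  (\prod_(q <- s) fine (mu q w (B q)) * cyl_mass w Q l)%:E.
Proof.
move=> mD bK placeK1 placeK2 + mB.
have mN := measurable_product_digits w.
have mplace q : measurable_fun [set: measurableTypeR R]
    (fun u => (fun n => N w u (place q n)) : bits).
  by apply: measurable_fun_bits => n; exact: (@measurable_bit _ _ _ (place q n) mN).
elim: s l => [|q0 s IHs] l us sQ lQ ls.
  rewrite big_nil mul1r -product_digit_law//; congr (lam _).
  by apply/seteqP; split => [u []|u].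
have /andP[q0s us'] := us.
pose F := [set u | forall q, q \in s -> B q (D (fun n => N w u (place q n)))] `&`
       [set u | bit_cyl l (N w u)].
have mF : measurable (F : set (measurableTypeR R)).
  apply: measurableI.
    rewrite (_ : [set u | _] = \big[setI/setT]_(q <- s)
       ((fun u => D (fun n => N w u (place q n))) @^-1` B q)).
      apply: bigsetI_measurable => q _; rewrite -[X in measurable X]setTI.
      exact: (measurableT_comp mD (mplace q)).
    by rewrite -bigcap_seq.
  by have := mN measurableT _ (measurable_bit_cyl l); rewrite setTI.
(* The contribution of everything but the event on [q0]. With the rest fixed, both sides are finite
   measures [m1] and [m2] of an event on the bits of [q0], so cylinders suffice to compare them. *)
pose c := \prod_(q <- s) fine (mu q w (B q)) * cyl_mass w Q l.
have c0 : 0 <= c.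
  rewrite mulr_ge0//; first by rewrite prodr_ge0// => q _; exact/fine_ge0/measure_ge0.
  by apply: prodr_ge0 => q _; exact: factor_ge0.
have [m1 m1E'] := image_measure (mplace q0) (mrestr lam mF).
have [m2 m2E'] := image_measure mb (mscale (NngNum c0) (mu q0 w)).
have m1E A : m1 A = lam ((fun u n => N w u (place q0 n)) @^-1` A `&` F) by rewrite m1E'.
have m2E A : m2 A = (c%:E * mu q0 w (b @^-1` A))%E by rewrite m2E'.
have m12 : forall A, measurable A -> m1 A = m2 A.
  apply: bits_measure_unique => [l'|]; last first.
    by rewrite m1E preimage_setT setTI -ge0_fin_numE// fin_num_measure.
  rewrite m1E m2E.
  (* A cylinder condition on the bits of [q0] is a list of digit constraints; it joins [l], which
     leads to the induction hypothesis. *)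
  pose l2 := [seq (place q0 p.1, p.2) | p <- l'].
  have coord_l2 p : p \in l2 -> coord p.1 = q0 by move=> /mapP[? _ ->] /=; rewrite placeK1.
  rewrite (_ : _ `&` F =
    [set u | forall q, q \in s -> B q (D (fun n => N w u (place q n)))] `&`
       [set u | bit_cyl (l2 ++ l) (N w u)]); last first.
    apply/seteqP; split => u /=.
      move=> [ul' [us0 ul]]; split => // p; rewrite mem_cat.
      by case/orP => [/mapP[p' /ul' + ->]|/ul].
    move=> [us0 ul]; split; last first.
      by split => // p pl; apply: ul; rewrite mem_cat pl orbT.
    by move=> p pl'; apply: (ul (place q0 p.1, p.2)); rewrite mem_cat;
      apply/orP; left; apply/mapP; exists p.
  rewrite IHs//.
  - have -> : cyl_mass w Q (l2 ++ l) = factor w l2 q0 * cyl_mass w Q l.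
      apply: cyl_mass_cat => //; first exact/sQ/mem_head.
      by move=> p /ls; rewrite inE negb_or => /andP[].
    rewrite mulrCA /c mulrC EFinM factorE factor_setE; congr (_ * mu _ _ (b @^-1` bit_cyl _))%E.
    rewrite (eq_in_filter (a2 := xpredT)); last by move=> p /coord_l2 ->; rewrite eqxx.
    rewrite filter_predT -map_comp -[RHS]map_id; apply: eq_map => -[n v] /=.
    by rewrite placeK2.
  - by move=> q qs; apply: sQ; rewrite inE qs orbT.
  - by move=> p; rewrite mem_cat => /orP[/coord_l2 ->|/lQ//]; apply: sQ; rewrite mem_head.
  - move=> p; rewrite mem_cat => /orP[/coord_l2 ->//|/ls].
    by rewrite inE negb_or => /andP[].
transitivity (m1 (D @^-1` B q0)).
  rewrite m1E; congr (lam _); apply/seteqP; split => u /=.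
    move=> [us0 ul]; split; first exact/us0/mem_head.
    by split => // q qs; apply: us0; rewrite inE qs orbT.
  move=> [uq0 [us0 ul]]; split => // q; rewrite inE => /orP[/eqP ->//|]; exact: us0.
rewrite m12; last by rewrite -[X in measurable X]setTI; exact: mD.
(* Decoding undoes coding, so the decoded bits have law [mu q0 w] itself. *)
rewrite m2E -comp_preimage (_ : D \o b = id) ?preimage_id; last exact/funext.
by rewrite big_cons -mulrA -/c mulrC [in RHS]EFinM fineK ?fin_num_measure.
Qed.

End product_digits.

(** A single uniform variable drives all the coordinates: their bits are interleaved through a
    pairing of the natural numbers. *)
Lemma randomization (R : realType) d (T : measurableType d) dW
    (W : measurableType dW) (mu : nat -> W -> probability T R) :
  coded T ->
  (forall q B, measurable B -> measurable_fun setT (fun w => mu q w B)) ->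
  exists2 Z : nat -> W * measurableTypeR R -> T,
    forall q, measurable_fun setT (Z q) &
    forall w (s : seq nat) (B : nat -> set T), uniq s ->
      (forall q, measurable (B q)) ->
      uniform_prob (@ltr01 R) [set u | forall q, q \in s -> B q (Z q (w, u))] =
      (\prod_(q <- s) fine (mu q w (B q)))%:E.
Proof.
move=> [b [D [mb mD bK]]] mmu.
pose place (q n : nat) := pickle (q, n).
(* By the default, a digit whose rank codes no pair would repeat bit 0 of coordinate 0; no
   coordinate reads such a digit. *)
pose unplace k : nat * nat := odflt (0, 0)%N (unpickle k).
have placeK q n : unplace (place q n) = (q, n) by rewrite /unplace pickleK.
pose coord k := (unplace k).1; pose index k := (unplace k).2.
pose N w u := digit (prefix_mass b mu coord index w) u.
exists (fun q wu => D (fun n => N wu.1 wu.2 (place q n))).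
  move=> q; apply: (measurableT_comp mD); apply: measurable_fun_bits => n.
  exact: (measurable_product_digit coord index mb mmu (place q n)).
move=> w s B us mB.
have sQ q : q \in s -> (q < (\max_(q <- s) q).+1)%N.
  by move=> qs; rewrite ltnS; exact: (@leq_bigmax_seq _ _ xpredT id).
have := @product_digit_indep _ _ _ _ _ b mu coord index mb mmu D w _ place s B [::]
  mD bK _ _ us mB sQ.
rewrite [X in _ `&` X](_ : _ = setT); last by apply/seteqP; split.
rewrite setIT /= => -> //.
- rewrite [cyl_mass _ _ _ _ _ _ _]big1 ?mulr1// => q _; exact: factor_id.
- by move=> q n; rewrite /coord placeK.
- by move=> q n; rewrite /index placeK.
Qed.

(** * Coding of Polish spaces by binary sequences *)

Section measurable_comprehensions.
Context {d} {T : measurableType d}.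

Lemma measurable_forall (P : nat -> set T) :
  (forall n, measurable (P n)) -> measurable [set x | forall n, P n x].
Proof.
move=> mP; rewrite (_ : [set x | _] = \bigcap_n P n); first exact: bigcapT_measurable.
by apply/seteqP; split => x Px n => [_|]; exact: Px.
Qed.

Lemma measurable_exists (P : nat -> set T) :
  (forall n, measurable (P n)) -> measurable [set x | exists n, P n x].
Proof.
move=> mP; rewrite (_ : [set x | _] = \bigcup_n P n); first exact: bigcupT_measurable.
by apply/seteqP; split => x [n]; [exists n|exists n].
Qed.

Lemma measurable_imply (Q : Prop) (P : set T) :
  measurable P -> measurable [set x | Q -> P x].
Proof.
have [q|nq] := pselect Q => mP.
  by rewrite (_ : [set x | _] = P)//; apply/seteqP; split => x Px; [exact: Px|].
by rewrite (_ : [set x | _] = setT)//; apply/seteqP; split => x // _ /nq.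
Qed.

Lemma measurable_andl (Q : Prop) (P : set T) :
  measurable P -> measurable [set x | Q /\ P x].
Proof.
have [q|nq] := pselect Q => mP.
  by rewrite (_ : [set x | _] = P)//; apply/seteqP; split => x => [[]|].
by rewrite (_ : [set x | _] = set0)//; apply/seteqP; split => x // [].
Qed.

End measurable_comprehensions.

Lemma measurable_fun_borel d (T : measurableType d) (X : ptopologicalType)
    (f : T -> borel X) :
  (forall U : set X, open U -> measurable (f @^-1` U)) -> measurable_fun setT f.
Proof.
move=> fU; apply: (@measurability _ _ T (borel X) setT f (@open X)) => // _ [U oU <-].
by rewrite setTI; exact: fU.
Qed.

Lemma measurable_open (X : ptopologicalType) (U : set X) :
  open U -> measurable (U : set (borel X)).
Proof. by move=> oU; exact: sub_sigma_algebra. Qed.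

Lemma polish_dense_seq (R : realType) (X : completePseudoMetricType R) :
  polish X ->
  exists x : nat -> X, forall y (e : R), 0 < e -> exists n, ball y e (x n).
Proof.
move=> [_ [D /pfcard_geP[D0|[x]] dD]].
  have [|y []] := dD setT _ openT; first by exists point.
  by rewrite D0.
exists x => y e e0.
have [|z [ze /(@surj _ _ setT D x)[n _ nz]]] := dD _ _ (open_interior (ball y e)).
  by exists y; exact: nbhsx_ballx.
by exists n; rewrite nz; exact: interior_subset ze.
Qed.

Section polish_coding.
Context {R : realType} {X : completePseudoMetricType R} (x : nat -> X).
Hypothesis hX : hausdorff_space X.
Hypothesis dx : forall y (e : R), 0 < e -> exists n, ball y e (x n).

Local Notation eps k := (k.+1%:R^-1 : R).

Let eps_gt0 k : 0 < eps k. Proof. by rewrite invr_gt0. Qed.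

Let eps_le k l : (k <= l)%N -> eps l <= eps k.
Proof. by move=> kl; rewrite lef_pV2 ?posrE// ler_nat. Qed.

Let eps_lt (e : R) : 0 < e -> exists k, eps k < e.
Proof.
move=> e0; have [k _ /(_ _ (leqnn k)) ke] := near_infty_natSinv_lt (PosNum e0).
by exists k.
Qed.

(** Interiors are taken because balls need not be open in this setting, and it is open sets that
    generate the Borel sets. *)
Definition ball_bits (y : X) : bits := fun n =>
  if unpickle n is Some (j, k) then `[< (ball (x j) (eps k))^° y >] else false.

Let bit_at (s : bits) (j k : nat) : bool := s (pickle (j, k)).

Let first_spec (s : bits) (k j : nat) : Prop :=
  bit_at s j k /\ forall j', (j' < j)%N -> ~ bit_at s j' k.

Definition first_bit (s : bits) (k : nat) : nat := xget 0%N [set j | first_spec s k j].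

(** Two centres within [eps k] and [eps l] of a common point satisfy this bound, so codes of points
    are [fast]; conversely completeness gives every [fast] sequence a limit, with a known rate. *)
Definition fast (s : bits) : Prop := forall k l, (k <= l)%N ->
  ball (x (first_bit s k)) (eps k + eps k) (x (first_bit s l)).

(** A constant value off the measurable set of [fast] sequences keeps the map measurable. *)
Definition ball_decode (s : bits) : X :=
  if pselect (fast s) then lim (x (first_bit s k) @[k --> \oo]) else point.

Let measurable_bit_at j k : measurable [set s | bit_at s j k].
Proof. exact: (@measurable_bit _ bits idfun _ (@measurable_id _ bits setT)). Qed.

Let measurable_first_spec k j : measurable [set s | first_spec s k j].
Proof.
apply: measurableI; first exact: measurable_bit_at.
apply: measurable_forall => j'; apply: measurable_imply.
exact: (measurableC (measurable_bit_at j' k)).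
Qed.

Let measurable_first_bit k j : measurable [set s | first_bit s k = j].
Proof.
(* The second set accounts for the default index 0, taken when no centre is marked at scale [k]. *)
rewrite (_ : [set s | _] = [set s | first_spec s k j] `|`
    [set s | j = 0%N /\ [set s | forall j, (~` [set s | first_spec s k j]) s] s]).
  apply: measurableU; first exact: measurable_first_spec.
  apply: measurable_andl; apply: measurable_forall => j'.
  exact: (measurableC (measurable_first_spec k j')).
apply/seteqP; split => s /=; rewrite /first_bit; case: xgetP => [i _ si|ns].
- by move=> <-; left.
- by move=> <-; right; split.
- move=> [sj|[_ /(_ i)//]]; case: si sj => [bi mi] [bj mj].
  by case: (ltngtP i j) => // [/mj|/mi].
- by move=> [/ns//|[->]].
Qed.

Let measurable_fast : measurable [set s | fast s].
Proof.
apply: measurable_forall => k; apply: measurable_forall => l; apply: measurable_imply.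
rewrite (_ : (fun s => _) = [set s | exists i, [set s | exists j,
    [set s | ball (x i) (eps k + eps k) (x j) /\
    ([set s | first_bit s k = i] `&` [set s | first_bit s l = j]) s] s] s]).
  apply: measurable_exists => i; apply: measurable_exists => j.
  by apply: measurable_andl; apply: measurableI; exact: measurable_first_bit.
apply/seteqP; split => s /=; first by exists (first_bit s k), (first_bit s l).
by move=> [i [j [ij [ki lj]]]]; rewrite ki lj.
Qed.

Lemma fast_cvg s : fast s -> x (first_bit s k) @[k --> \oo] --> ball_decode s.
Proof.
move=> fs; rewrite /ball_decode; case: pselect => // {}fs.
apply: cauchy_cvg; apply: cauchy_exP => e e0.
have [k ke] : exists k, eps k < e / 2 by apply: eps_lt; rewrite divr_gt0.
exists (x (first_bit s k)); exists k => // l /= kl.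
by apply: (le_ball _ (fs _ _ kl)); move: (eps k) ke => t ?; lra.
Qed.

(** Two [eps k] come from [fast], the third from passing from a late centre to the limit. *)
Lemma fast_ball s k : fast s ->
  ball (x (first_bit s k)) (eps k + eps k + eps k) (ball_decode s).
Proof.
move=> fs; have /cvg_ballP/(_ _ (eps_gt0 k))[l _ lk] := fast_cvg fs.
apply: ball_triangle (fs k (maxn k l) (leq_maxl _ _)) _.
by apply: ball_sym; apply: lk; rewrite /= leq_maxr.
Qed.

(** The limit of a [fast] sequence lies in an open [U] exactly when, at some scale, the whole ball
    that [fast_ball] guarantees lies in [U]: a countable condition on the bits. *)
Lemma measurable_ball_decode : measurable_fun setT (ball_decode : bits -> borel X).
Proof.
apply: measurable_fun_borel => U oU.
rewrite (_ : _ @^-1` U = ([set s | fast s] `&` [set s | exists k, [set s | exists j,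
    [set s | ball (x j) (eps k + eps k + eps k) `<=` U /\
      [set s | first_bit s k = j] s] s] s]) `|`
    [set s | U point /\ (~` [set s | fast s]) s]).
  apply: measurableU.
    apply: measurableI; first exact: measurable_fast.
    apply: measurable_exists => k; apply: measurable_exists => j.
    by apply: measurable_andl; exact: measurable_first_bit.
  by apply: measurable_andl; exact: (measurableC measurable_fast).
apply/seteqP; split => s /=.
  have [fs Us|nfs] := pselect (fast s); last first.
    by move=> Us; right; split => //; move: Us; rewrite /ball_decode; case: pselect.
  left; split => //.
  have /nbhs_ballP[e /= e0 eU] : nbhs (ball_decode s) U by exact: open_nbhs_nbhs.
  (* The limit and [y] are each within three [eps k] of the centre. *)
  have [k ke] : exists k, eps k < e / 6 by apply: eps_lt; rewrite divr_gt0.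
  exists k, (first_bit s k); split => // y ky; apply: eU.
  apply: (le_ball _ (ball_triangle (ball_sym (fast_ball k fs)) ky)).
  by move: (eps k) ke => t ?; lra.
move=> [[fs [k [j [jU jE]]]]|[Up nfs]].
  by apply: jU; rewrite -jE; exact: fast_ball.
by rewrite /ball_decode; case: pselect.
Qed.

Lemma measurable_ball_bits : measurable_fun setT (ball_bits : borel X -> bits).
Proof.
apply: measurable_fun_bits => n; rewrite /ball_bits.
case: (unpickle n) => [[j k]|]; last first.
  by rewrite (_ : [set t | _] = set0)//; apply/seteqP; split.
rewrite (_ : [set t | _] = (ball (x j) (eps k))^°).
  by apply: measurable_open; exact: open_interior.
by apply/seteqP; split => t /asboolP.
Qed.

Lemma ball_bitsK : cancel ball_bits ball_decode.
Proof.
move=> y; have bitE j k : bit_at (ball_bits y) j k <-> (ball (x j) (eps k))^° y.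
  by rewrite /bit_at /ball_bits pickleK; split => /asboolP.
have firstP k : ball (x (first_bit (ball_bits y) k)) (eps k) y.
  rewrite /first_bit; case: xgetP => [j _ [/bitE/interior_subset//]|ns].
  (* A centre at half the distance puts [y] in the interior of the ball of radius [eps k]. *)
  have [|j yj] := dx y (e := eps k / 2); first by rewrite divr_gt0.
  have bj : exists j, bit_at (ball_bits y) j k.
    exists j; apply/bitE; rewrite /interior.
    apply/nbhs_ballP; exists (eps k / 2) => /=; first by rewrite divr_gt0.
    move=> z yz; rewrite [eps k]splitr; apply: ball_triangle yz.
    exact: ball_sym.
  case: (ns (ex_minn bj)); case: ex_minnP => i bi mi; split => // j' j'i b'.
  by have := mi _ b'; rewrite leqNgt j'i.
have fy : fast (ball_bits y).
  move=> k l kl; apply: ball_triangle (firstP k) _; apply: ball_sym.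
  exact: (le_ball (eps_le kl) (firstP l)).
apply: (cvg_unique hX (fast_cvg fy)); apply/cvg_ballP => e e0.
have [k ke] := eps_lt e0; exists k => // l /= kl.
apply: ball_sym; apply: (le_ball _ (firstP l)).
exact: le_trans (eps_le kl) (ltW ke).
Qed.

End polish_coding.

Lemma polish_coded (R : realType) (X : completePseudoMetricType R) :
  polish X -> coded (borel X).
Proof.
move=> pX; have [x dx] := polish_dense_seq pX; have [hX _] := pX.
exists (ball_bits x), (ball_decode x); split.
- exact: measurable_ball_bits.
- exact: measurable_ball_decode.
- exact: ball_bitsK.
Qed.

(** * Expectations of bounded functions and kernels *)

Section bounded_functions.
Context {d} {T : measurableType d} {R : realType}.
Implicit Types f g : T -> R.

Definition mbounded f := measurable_fun setT f /\ exists M, forall x, `|f x| <= M.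

Lemma mboundedD f g : mbounded f -> mbounded g -> mbounded (fun x => f x + g x).
Proof.
move=> [mf [M fM]] [mg [N gN]]; split; first exact: measurable_funD.
by exists (M + N) => x; exact: le_trans (ler_normD _ _) (lerD (fM x) (gN x)).
Qed.

Lemma mboundedM f g : mbounded f -> mbounded g -> mbounded (fun x => f x * g x).
Proof.
move=> [mf [M fM]] [mg [N gN]]; split; first exact: measurable_funM.
by exists (M * N) => x; rewrite normrM ler_pM.
Qed.

Lemma mbounded_cst (c : R) : mbounded (fun=> c).
Proof. by split; [exact: measurable_cst|exists `|c|]. Qed.

Lemma mboundedN f : mbounded f -> mbounded (fun x => - f x).
Proof.
move=> [mf [M fM]]; split; first exact: measurableT_comp.
by exists M => x; rewrite normrN.
Qed.

Lemma mboundedB f g : mbounded f -> mbounded g -> mbounded (fun x => f x - g x).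
Proof. by move=> bf bg; apply: mboundedD => //; exact: mboundedN. Qed.

Lemma mbounded_norm f : mbounded f -> mbounded (fun x => `|f x|).
Proof.
move=> [mf [M fM]]; split; first exact: measurableT_comp.
by exists M => x; rewrite normr_id.
Qed.

Lemma mbounded_indic (A : set T) : measurable A -> mbounded (\1_A : T -> R).
Proof.
move=> mA; split; first exact: measurable_indic.
by exists 1 => x; rewrite indicE; case: (x \in A); rewrite ?normr1 ?normr0.
Qed.

Lemma mbounded_sum (I : Type) (s : seq I) (P : pred I) (f : I -> T -> R) :
  (forall i, P i -> mbounded (f i)) -> mbounded (fun x => \sum_(i <- s | P i) f i x).
Proof.
move=> bf; elim: s => [|i s IHs].
  by under eq_fun do rewrite big_nil; exact: mbounded_cst.
under eq_fun do rewrite big_cons.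
by case Pi: (P i) => //; apply: mboundedD => //; exact: bf.
Qed.

Lemma mbounded_prod (I : Type) (s : seq I) (f : I -> T -> R) :
  (forall i, mbounded (f i)) -> mbounded (fun x => \prod_(i <- s) f i x).
Proof.
move=> bf; elim: s => [|i s IHs].
  by under eq_fun do rewrite big_nil; exact: mbounded_cst.
by under eq_fun do rewrite big_cons; exact: mboundedM.
Qed.

Lemma mbounded01 f : measurable_fun setT f -> (forall x, 0 <= f x <= 1) -> mbounded f.
Proof.
move=> mf f01; split => //; exists 1 => x.
by have /andP[? ?] := f01 x; rewrite ger0_norm.
Qed.

End bounded_functions.

Lemma mbounded_comp d d' (T : measurableType d) (T' : measurableType d')
  (R : realType) (f : T' -> R) (g : T -> T') :
  mbounded f -> measurable_fun setT g -> mbounded (fun x => f (g x)).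
Proof.
by move=> [mf [M fM]] mg; split; [exact: measurableT_comp|exists M => x].
Qed.

Section expectation_of_bounded_functions.
Context {d} {T : measurableType d} {R : realType} (P : probability T R).
Implicit Types f g : T -> R.

Lemma mbounded_integrable f : mbounded f -> P.-integrable setT (EFin \o f).
Proof.
move=> [mf [M fM]]; apply: measurable_bounded_integrable => //.
  by rewrite -ge0_fin_numE// fin_num_measure.
exists M; split; first exact: num_real.
by move=> N MN x _; exact: le_trans (fM x) (ltW MN).
Qed.

Lemma EFin_RintegralT f : mbounded f ->
  (\int[P]_x f x)%:E = (\int[P]_x (f x)%:E)%E.
Proof.
by move=> bf; rewrite /Rintegral fineK//; apply: integrable_fin_num => //;
   exact: mbounded_integrable.
Qed.

Lemma RintegralTD f g : mbounded f -> mbounded g ->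
  \int[P]_x (f x + g x) = \int[P]_x f x + \int[P]_x g x.
Proof. by move=> bf bg; rewrite RintegralD//; exact: mbounded_integrable. Qed.

Lemma RintegralTB f g : mbounded f -> mbounded g ->
  \int[P]_x (f x - g x) = \int[P]_x f x - \int[P]_x g x.
Proof. by move=> bf bg; rewrite RintegralB//; exact: mbounded_integrable. Qed.

Lemma RintegralTZl c f : mbounded f -> \int[P]_x (c * f x) = c * \int[P]_x f x.
Proof. by move=> bf; rewrite RintegralZl//; exact: mbounded_integrable. Qed.

Lemma RintegralT_cst c : \int[P]_x c = c.
Proof. by rewrite Rintegral_cst// [X in fine X]probability_setT/= mulr1. Qed.

Lemma RintegralT_sum (I : Type) (s : seq I) (f : I -> T -> R) :
  (forall i, mbounded (f i)) ->
  \int[P]_x (\sum_(i <- s) f i x) = \sum_(i <- s) \int[P]_x f i x.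
Proof.
move=> bf; elim: s => [|i s IHs].
  by under eq_Rintegral do rewrite big_nil; rewrite RintegralT_cst big_nil.
under eq_Rintegral do rewrite big_cons.
by rewrite RintegralTD ?IHs ?big_cons//; exact: mbounded_sum.
Qed.

Lemma le_RintegralT f g : mbounded f -> mbounded g -> (forall x, f x <= g x) ->
  \int[P]_x f x <= \int[P]_x g x.
Proof. by move=> bf bg fg; apply: le_Rintegral => //; exact: mbounded_integrable. Qed.

Lemma RintegralT_indic (A : set T) : measurable A -> \int[P]_x \1_A x = fine (P A).
Proof. by move=> mA; rewrite /Rintegral integral_indic// setIT. Qed.

Lemma Rintegral_mul_indic (A : set T) f :
  \int[P]_x (\1_A x * f x) = \int[P]_(x in A) f x.
Proof.
rewrite [RHS]Rintegral_mkcond; apply: eq_Rintegral => x _.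
by rewrite patchE indicE; case: ifP => _; rewrite ?mul1r ?mul0r.
Qed.

Lemma le_norm_RintegralT f g : mbounded f -> mbounded g ->
  (forall x, `|f x| <= g x) -> `|\int[P]_x f x| <= \int[P]_x g x.
Proof.
move=> bf bg fg; apply: le_trans (le_normr_Rintegral _ _) _ => //.
  exact: mbounded_integrable.
by apply: le_RintegralT => //; exact: mbounded_norm.
Qed.

Lemma RintegralT_01 f : mbounded f -> (forall x, 0 <= f x <= 1) ->
  0 <= \int[P]_x f x <= 1.
Proof.
move=> bf f01; apply/andP; split.
  by rewrite -(RintegralT_cst 0) le_RintegralT//; [exact: mbounded_cst|
     move=> x; have /andP[] := f01 x].
by rewrite -(RintegralT_cst 1) le_RintegralT//; [exact: mbounded_cst|
   move=> x; have /andP[] := f01 x].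
Qed.

End expectation_of_bounded_functions.

Section layers.
Context {R : realType} {T : Type}.

(* The layer-cake approximation from below of a function with values in [0, 1],
   with strict superlevel sets, hence open ones for a continuous function. *)
Definition layer (N : nat) (h : T -> R) (k : nat) : set T :=
  [set x | k.+1%:R < N.+1%:R * h x].

Definition layer_cake (N : nat) (h : T -> R) (x : T) : R :=
  N.+1%:R^-1 * \sum_(k < N.+1) \1_(layer N h k) x.

(** Scaled by [N.+1], the sum counts the integers from 1 to [N.+1] that are strictly below [y];
    since [y] is at most [N.+1], this count is within 1 of [y]. *)
Lemma layer_cake_bounds N h x : 0 <= h x <= 1 ->
  layer_cake N h x <= h x <= layer_cake N h x + N.+1%:R^-1.
Proof.
move=> /andP[h0 h1]; rewrite /layer_cake; set S := \sum_(k < N.+1) _.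
set y := N.+1%:R * h x.
suff /andP[Sy yS] : S <= y <= S + 1.
  have hE : h x = N.+1%:R^-1 * y by rewrite mulKf.
  by rewrite hE -[X in _ + X]mulr1 -mulrDr !ler_pM2l ?invr_gt0// Sy.
have yN : y <= N.+1%:R by rewrite /y ler_piMr.
have y0 : 0 <= y by rewrite /y mulr_ge0.
(* The middle clause says that no term is missing before [y] is passed; it fixes the value of the
   sum when the next term is examined. *)
suff H n : let S := \sum_(k < n) (\1_(layer N h k) x : R) in
    [/\ S <= y, (n%:R < y -> S = n%:R) & (y <= n%:R -> y <= S + 1)].
  by have [Sy _ /(_ yN) yS] := H N.+1; rewrite Sy.
elim: n => [|n [IH1 IH2 IH3]] /=.
  by rewrite big_ord0; split => // yn; lra.
rewrite big_ord_recr /= indicE.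
have [/asboolP ny|ny] := boolP (x \in layer N h n).
  have {}ny : n.+1%:R < y := ny.
  have nn : n.+1%:R = n%:R + 1 :> R by rewrite -natr1.
  have -> : \sum_(i < n) (\1_(layer N h i) x : R) = n%:R by apply: IH2; lra.
  by rewrite /= nn; split => //; lra.
have {}ny : y <= n.+1%:R by move: ny; rewrite notin_setE /layer/= => /negP; rewrite -leNgt.
have nn : n.+1%:R = n%:R + 1 :> R by rewrite -natr1.
rewrite addr0; split => //; first lra.
move=> _; have [yn|/IH2 ->] := leP y n%:R; first by have := IH3 yn; lra.
lra.
Qed.

End layers.

(** * Conditional expectations given a sub-sigma-algebra *)

Section sub_sigma_algebras.
Context {d} {Omega : measurableType d} (H : set_system Omega).
Hypothesis sH : sigma_algebra setT H.

Lemma measurable_sub_sigmaE (A : set Omega) :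
  measurable (A : set (g_sigma_algebraType H)) = H A.
Proof. by rewrite /measurable/= (sigma_algebra_id sH). Qed.

Lemma measurable_wrtP d' (T : measurableType d') (f : Omega -> T) :
  measurable_wrt H f <-> measurable_fun setT (f : g_sigma_algebraType H -> T).
Proof.
split=> [Hf _ B mB|mf B mB]; first by rewrite setTI measurable_sub_sigmaE; exact: Hf.
by have := mf measurableT _ mB; rewrite setTI measurable_sub_sigmaE.
Qed.

Hypothesis Hm : H `<=` measurable.

Lemma measurable_wrt_fun d' (T : measurableType d') (f : Omega -> T) :
  measurable_wrt H f -> measurable_fun setT f.
Proof. by move=> Hf _ B mB; rewrite setTI; exact/Hm/Hf. Qed.

Lemma measurable_fun_sub_sigma :
  measurable_fun setT (id : Omega -> g_sigma_algebraType H).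
Proof. by move=> _ A; rewrite measurable_sub_sigmaE setTI preimage_id => /Hm. Qed.

(** The c.i.d. hypothesis speaks of given versions of conditional expectations, so versions must be
    produced before it says anything. They are Radon-Nikodym derivatives for the restriction of [P]
    to [H], obtained as the image of [P] under the identity. *)
Lemma cond_exp_exists (R : realType) (P : probability Omega R) (f : Omega -> R) :
  P.-integrable setT (EFin \o f) -> exists g, cond_exp_version P H f g.
Proof.
move=> intf; have mid := measurable_fun_sub_sigma.
pose mu := distribution P (mfun_Sub (mem_set mid)).
have [nu nuE] : exists nu : {charge set (g_sigma_algebraType H) -> \bar R},
    forall A, nu A = (\int[P]_(x in A) (f x)%:E)%E.
  by unshelve eexists (pushforward (induced_charge intf)
    (id : Omega -> g_sigma_algebraType H)).
have numu : nu `<< mu.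
  apply/null_content_dominatesP => A mA muA; rewrite nuE.
  apply: null_set_integral => //; first by apply: Hm; rewrite -measurable_sub_sigmaE.
  by apply: measurable_funTS; exact: (measurable_int P).
pose rn := Radon_Nikodym nu mu.
have irn : mu.-integrable setT rn by exact: Radon_Nikodym_integrable.
have rnE : rn = EFin \o (fine \o rn).
  by apply/funext => x /=; rewrite fineK// Radon_Nikodym_fin_num.
have mrn : measurable_fun setT rn by exact: (measurable_int mu).
have irnP : P.-integrable setT rn.
  apply/integrableP; split; first exact: (measurableT_comp mrn mid).
  have /integrableP[_] := irn.
  by rewrite ge0_integral_distribution//; apply: measurableT_comp.
exists (fine \o rn); split.
- by apply/measurable_wrtP; apply: measurableT_comp mrn; exact: fine_measurable.
- by rewrite -rnE.
- move=> A HA; rewrite -nuE.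
  have mA : measurable (A : set (g_sigma_algebraType H)) by rewrite measurable_sub_sigmaE.
  rewrite (Radon_Nikodym_integral numu mA).
  rewrite [RHS](@integral_pushforward _ _ _ _ _ _ mid P A rn mrn _ mA)//.
    by apply: eq_integral => x _; rewrite [in RHS]rnE.
  by apply: integrableS irnP => //; exact: Hm.
Qed.

End sub_sigma_algebras.

(** * Means of functions under kernels *)

Section kernel_means.
Context {R : realType} {d} {Omega : measurableType d} {d'} {T : measurableType d'}.
Variable P : probability Omega R.

Definition kernel_mean (k : Omega -> probability T R) (h : T -> R) (w : Omega) : R :=
  \int[k w]_x h x.

Lemma kernel_mean_01 k h : mbounded h -> (forall x, 0 <= h x <= 1) ->
  forall w, 0 <= kernel_mean k h w <= 1.
Proof. by move=> bh h01 w; exact: RintegralT_01. Qed.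

Lemma measurable_kernel_mean (k : Omega -> probability T R) (h : T -> R) :
  (forall B, measurable B -> measurable_fun setT (fun w => k w B)) ->
  measurable_fun setT h -> (forall x, 0 <= h x <= 1) ->
  measurable_fun setT (kernel_mean k h).
Proof.
move=> mk mh h01; apply: (measurableT_comp (fine_measurable measurableT)).
apply: (@measurable_fun_integral_kernel _ _ _ _ _ (fun w => k w : measure _ _)) => //.
  by move=> x; rewrite lee_fin; have /andP[] := h01 x.
exact/measurable_EFinP.
Qed.

Lemma mbounded_kernel_mean (k : Omega -> probability T R) (h : T -> R) :
  (forall B, measurable B -> measurable_fun setT (fun w => k w B)) ->
  measurable_fun setT h -> (forall x, 0 <= h x <= 1) ->
  mbounded (kernel_mean k h).
Proof.
move=> mk mh h01; apply: mbounded01; first exact: measurable_kernel_mean.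
by apply: kernel_mean_01 => //; exact: mbounded01.
Qed.

Lemma measurable_layer N (h : T -> R) n :
  measurable_fun setT h -> measurable (layer N h n).
Proof.
move=> mh; rewrite -[X in measurable X]setTI.
apply: (measurable_fun_ltr (f := cst n.+1%:R) (g := fun x => N.+1%:R * h x)
  _ _ measurableT (Y := [set true])) => //.
exact: measurable_funM.
Qed.

Let kernel_mean_layer (k : Omega -> probability T R) (phi : Omega -> R) (h : T -> R) N :
  (forall B, measurable B -> measurable_fun setT (fun w => k w B)) ->
  mbounded phi -> (forall w, 0 <= phi w <= 1) ->
  measurable_fun setT h -> (forall x, 0 <= h x <= 1) ->
  `|\int[P]_w (phi w * kernel_mean k h w) - N.+1%:R^-1 *
    \sum_(i < N.+1) \int[P]_w (phi w * fine (k w (layer N h i)))| <= N.+1%:R^-1.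
Proof.
move=> mk bphi phi01 mh h01.
have bh : mbounded h by exact: mbounded01.
have mL i : measurable (layer N h i) by exact: measurable_layer.
have bk i : mbounded (fun w => fine (k w (layer N h i))).
  apply: mbounded01.
    by apply: (measurableT_comp (fine_measurable measurableT)); exact: mk.
  move=> w; rewrite fine_ge0//= -lee_fin fineK ?probability_le1//.
  exact: fin_num_measure.
have bphik i : mbounded (fun w => phi w * fine (k w (layer N h i))) by exact: mboundedM.
have bS : mbounded (fun x => \sum_(i < N.+1) \1_(layer N h i) x : R).
  by apply: mbounded_sum => i _; exact: mbounded_indic.
have bC : mbounded (layer_cake N h) by apply: mboundedM => //; exact: mbounded_cst.
have CE w : kernel_mean k (layer_cake N h) w =
    N.+1%:R^-1 * \sum_(i < N.+1) fine (k w (layer N h i)).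
  rewrite /kernel_mean RintegralTZl// RintegralT_sum; last first.
    by move=> i; exact: mbounded_indic.
  by congr (_ * _); apply: eq_bigr => i _; rewrite RintegralT_indic.
have bkC : mbounded (kernel_mean k (layer_cake N h)).
  rewrite (funext CE); apply: mboundedM; first exact: mbounded_cst.
  by apply: mbounded_sum => i _.
rewrite -RintegralT_sum// -RintegralTZl; last by apply: mbounded_sum.
have bkh := mbounded_kernel_mean mk mh h01.
rewrite -RintegralTB; last 2 first.
- exact: mboundedM.
- by apply: mboundedM; [exact: mbounded_cst|exact: mbounded_sum].
rewrite -[leRHS](RintegralT_cst P) le_norm_RintegralT//.
- apply: mboundedB; first exact: mboundedM.
  by apply: mboundedM; [exact: mbounded_cst|exact: mbounded_sum].
- exact: mbounded_cst.
move=> w; rewrite -mulr_sumr mulrCA -CE -mulrBr normrM.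
have /andP[p0 p1] := phi01 w; rewrite ger0_norm// -[leRHS]mul1r ler_pM//.
rewrite /kernel_mean -RintegralTB// -[leRHS](RintegralT_cst (k w)).
apply: le_norm_RintegralT; [exact: mboundedB|exact: mbounded_cst|].
move=> x; have /andP[c0 c1] := layer_cake_bounds N (h01 x).
by rewrite ger0_norm ?subr_ge0// lerBlDl.
Qed.

(** An identity known for sets passes to functions, since the layer-cake error is uniform. With
    Dirac kernels, [h] evaluated at a random point becomes a kernel mean, which is how the lemma is
    mostly applied. *)
Lemma eq_kernel_mean (k k' : Omega -> probability T R)
  (phi phi' : Omega -> R) (h : T -> R) :
  (forall B, measurable B -> measurable_fun setT (fun w => k w B)) ->
  (forall B, measurable B -> measurable_fun setT (fun w => k' w B)) ->
  mbounded phi -> (forall w, 0 <= phi w <= 1) ->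
  mbounded phi' -> (forall w, 0 <= phi' w <= 1) ->
  (forall B, measurable B -> \int[P]_w (phi w * fine (k w B)) =
     \int[P]_w (phi' w * fine (k' w B))) ->
  measurable_fun setT h -> (forall x, 0 <= h x <= 1) ->
  \int[P]_w (phi w * kernel_mean k h w) = \int[P]_w (phi' w * kernel_mean k' h w).
Proof.
move=> mk mk' bphi phi01 bphi' phi'01 kk' mh h01.
apply/eqP; rewrite -subr_eq0 -normr_le0; apply/ler_addgt0Pl => e e0; rewrite addr0.
(* One layer-cake error for each side. *)
have [N _ /(_ _ (leqnn N)) Ne] := near_infty_natSinv_lt (PosNum (divr_gt0 e0 (ltr0n _ 2))).
have := kernel_mean_layer N mk bphi phi01 mh h01.
have := kernel_mean_layer N mk' bphi' phi'01 mh h01.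
rewrite (eq_bigr (fun i : 'I_N.+1 => \int[P]_w (phi w * fine (k w (layer N h i))))); last first.
  by move=> i _; rewrite kk'//; exact: measurable_layer.
move: Ne => /=; move: (N.+1%:R^-1) (_ * \sum_(_ < _) _) => t s Ne.
rewrite !ler_norml => /andP[? ?] /andP[? ?]; apply/andP; split; lra.
Qed.

Lemma kernel_mean_dirac (X : Omega -> T) (h : T -> R) w : measurable_fun setT h ->
  kernel_mean (fun w => \d_(X w)) h w = h (X w).
Proof.
move=> mh; rewrite /kernel_mean /Rintegral integral_dirac//=; last exact/measurable_EFinP.
by rewrite indicT mul1r.
Qed.

Lemma measurable_dirac_kernel (X : Omega -> T) (B : set T) :
  measurable_fun setT X -> measurable B ->
  measurable_fun setT (fun w => \d_(X w) B : \bar R).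
Proof.
move=> mX mB; rewrite (_ : (fun w => _) = EFin \o (\1_(X @^-1` B))).
  apply/measurable_EFinP; apply: measurable_indic.
  by rewrite -[X in measurable X]setTI; exact: mX.
by apply/funext => w; rewrite diracE /= indicE; congr ((_ : bool)%:R)%:E; apply/idP/idP; rewrite !inE.
Qed.

End kernel_means.

Lemma measurable_continuous_borel (R : realType) (X : completePseudoMetricType R)
    (f : X -> R) : continuous f -> measurable_fun [set: borel X] (f : borel X -> R).
Proof.
move=> cf; apply: (measurability _ (RGenOInfty.measurableE R)) => _ [_ [r ->] <-].
rewrite setTI; apply: measurable_open; apply: open_comp => [x _|]; first exact: cf.
exact: interval_open.
Qed.

(** * Partially c.i.d. arrays *)

Section cid_arrays.
Context {R : realType} {d : measure_display} {Omega : measurableType d}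
  (P : probability Omega R) {Xs : completePseudoMetricType R} {I : countType}
  (G : nat -> set_system Omega) (X : nat -> I -> Omega -> borel Xs)
  (alpha : I -> Omega -> probability (borel Xs) R).
Hypothesis cidX : partially_cid P G X.
Hypothesis dirX : directing_measures P G X alpha.

Let sG n : sigma_algebra setT (G n).
Proof. by have [[sG _ _] _ _] := cidX; exact: sG. Qed.

Let Gm n : G n `<=` measurable.
Proof. by have [[_ Gm _] _ _] := cidX; exact: Gm. Qed.

Let Gle n m : (n <= m)%N -> G n `<=` G m.
Proof.
move=> nm; rewrite -(subnKC nm); elim: (m - n)%N => [|k IHk]; first by rewrite addn0.
by rewrite addnS; have [[_ _ GS] _ _] := cidX; exact: subset_trans IHk (GS _).
Qed.

Let XG n i : measurable_wrt (G n.+1) (X n.+1 i).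
Proof. by have [_ XG _] := cidX; exact: XG. Qed.

Let sGnj n j : sigma_algebra setT (Gnj G X n j).
Proof. exact: smallest_sigma_algebra. Qed.

Let GnjS n j : Gnj G X n j `<=` G n.+1.
Proof.
apply: smallest_sub; first exact: sG.
move=> A [GA|[i [B [_ mB ->]]]]; first exact: Gle GA.
exact: XG.
Qed.

Let Gnjm n j : Gnj G X n j `<=` measurable.
Proof. by move=> A /GnjS/Gm. Qed.

Lemma measurable_array n i : measurable_fun setT (X n.+1 i).
Proof. by apply: (measurable_wrt_fun (Gm (n := n.+1))); exact: XG. Qed.

Lemma mbounded_test (f : Xs -> R) n i :
  measurable_fun [set: borel Xs] (f : borel Xs -> R) -> (forall x, 0 <= f x <= 1) ->
  mbounded (fun w => f (X n.+1 i w)).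
Proof.
move=> mf f01; apply: (@mbounded_comp _ _ _ (borel Xs)); first exact: mbounded01.
exact: measurable_array.
Qed.

(** The c.i.d. property integrated over an event of [Gnj], free of conditional expectations. *)
Lemma cid_shift (f : Xs -> R) n j k A :
  measurable_fun [set: borel Xs] (f : borel Xs -> R) -> (forall x, 0 <= f x <= 1) ->
  Gnj G X n j A ->
  \int[P]_w (\1_A w * f (X n.+1 j w)) = \int[P]_w (\1_A w * f (X (n + k.+1)%N j w)).
Proof.
move=> mf f01 GA.
have bf m : P.-integrable setT (EFin \o (f \o X m.+1 j)).
  by apply: mbounded_integrable; exact: mbounded_test.
have [g1 g1E] := cond_exp_exists (@sGnj n j) (@Gnjm n j) (bf n).
have [g2] := cond_exp_exists (@sGnj n j) (@Gnjm n j) (bf (n + k)%N).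
rewrite -addnS => g2E.
have bmf : bounded_measurable f.
  by split => //; exists 1 => x; have /andP[? ?] := f01 x; rewrite ger0_norm.
have [_ _ /(_ j n k.+1 isT f bmf _ _ g1E g2E) g12] := cidX.
rewrite !Rintegral_mul_indic /Rintegral; congr fine.
have [mg1 _ /(_ _ GA) <-] := g1E; have [mg2 _ /(_ _ GA) <-] := g2E.
apply: ae_eq_integral => //.
- exact: Gnjm GA.
- apply/measurable_EFinP/measurable_funTS.
  exact: (measurable_wrt_fun (@Gnjm n j)).
- apply/measurable_EFinP/measurable_funTS.
  exact: (measurable_wrt_fun (@Gnjm n j)).
- by apply: filterS g12 => w /= -> _.
Qed.

Lemma mbounded_limit (f : Xs -> R) i :
  measurable_fun [set: borel Xs] (f : borel Xs -> R) -> (forall x, 0 <= f x <= 1) ->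
  mbounded (kernel_mean (alpha i) f).
Proof.
move=> mf f01; apply: mbounded_kernel_mean => //.
by move=> B mB; have [/(_ i B mB)] := dirX.
Qed.

Lemma limit_01 (f : Xs -> R) i :
  measurable_fun [set: borel Xs] (f : borel Xs -> R) -> (forall x, 0 <= f x <= 1) ->
  forall w, 0 <= kernel_mean (alpha i) f w <= 1.
Proof. by move=> mf f01; apply: kernel_mean_01 => //; exact: mbounded01. Qed.

(** [V n] is a version of the conditional mean of [f] at row n+1 given [G n]. Continuity of [f] lets
    weak convergence act almost surely, and the bound by 1 upgrades this to L1 convergence. *)
Lemma predictive_means (f : Xs -> R) i : continuous f -> (forall x, 0 <= f x <= 1) ->
  exists V : nat -> Omega -> R,
    [/\ forall n, measurable_wrt (G n) (V n),
        forall n w, 0 <= V n w <= 1,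
        forall n A, G n A ->
          \int[P]_w (\1_A w * f (X n.+1 i w)) = \int[P]_w (\1_A w * V n w) &
        (fun n => \int[P]_w `|V n w - kernel_mean (alpha i) f w|) @ \oo --> (0 : R)].
Proof.
move=> cf f01; have [_ /(_ i)[k [kE kw]]] := dirX.
have mf := measurable_continuous_borel cf.
have mkG n B : measurable B -> measurable_fun setT
    (fun w : g_sigma_algebraType (G n) => k n w B).
  move=> mB; have [/(measurable_wrtP (sG n))/measurable_EFinP + _ _] := kE n _ mB.
  by congr measurable_fun; apply/funext => w /=; rewrite fineK ?fin_num_measure.
have mV n : measurable_wrt (G n) (kernel_mean (k n) f).
  apply/(measurable_wrtP (sG n)).
  exact: (@measurable_kernel_mean R _ (g_sigma_algebraType (G n)) _ (borel Xs) (k n) f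
    (mkG n) mf f01).
have mk n B : measurable B -> measurable_fun setT (fun w => k n w B).
  by move=> mB _ Y mY; rewrite setTI; apply: (Gm (n := n));
     have := mkG n B mB measurableT _ mY; rewrite setTI measurable_sub_sigmaE.
have V01 n : forall w, 0 <= kernel_mean (k n) f w <= 1.
  by apply: kernel_mean_01 => //; exact: mbounded01.
exists (fun n => kernel_mean (k n) f); split => //.
- move=> n A GA; have mA := Gm GA.
  have bA : mbounded (\1_A : Omega -> R) by exact: mbounded_indic.
  have A01 w : 0 <= (\1_A w : R) <= 1 by rewrite indicE; case: (w \in A); rewrite /= lexx ler01.
  (* The predictive kernels are specified on sets only; the Dirac kernel at the entry carries this
     over to [f]. *)
  rewrite -(@eq_kernel_mean _ _ _ _ (borel Xs) P (fun w => \d_(X n.+1 i w)) (k n) \1_A \1_A)//.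
  + by apply: eq_Rintegral => w _; rewrite kernel_mean_dirac.
  + by move=> B mB; apply: measurable_dirac_kernel => //; exact: measurable_array.
  + exact: mk.
  + move=> B mB; rewrite !Rintegral_mul_indic /Rintegral; congr fine.
    by have [_ _ ->] := kE n _ mB.
- have bV n : mbounded (kernel_mean (k n) f) by apply: mbounded_kernel_mean => //; exact: mk.
  have bl := mbounded_limit i mf f01.
  have mE (g : Omega -> R) : mbounded g -> measurable_fun setT (EFin \o g).
    by move=> [mg _]; exact/measurable_EFinP.
  have [] := @dominated_convergence _ _ _ P setT measurableT
    (fun n w => (kernel_mean (k n) f w)%:E) (fun w => (kernel_mean (alpha i) f w)%:E)
    (cst 1%E) (fun n => mE _ (bV n)) (mE _ bl).
  + apply: filterS kw => w /(_ f cf) kf _.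
    have bf : mbounded (f : borel Xs -> R) by exact: mbounded01.
    rewrite EFin_RintegralT//; under eq_fun do rewrite EFin_RintegralT//.
    by apply: kf; exists 1 => x; have /andP[? ?] := f01 x; rewrite ger0_norm.
  + exact: (mbounded_integrable P (mbounded_cst 1)).
  + apply: aeW => w n _; rewrite lee_fin.
    by have /andP[? ?] := V01 n w; rewrite ger0_norm.
  by move=> _ /fine_cvg.
Qed.

(** On an event of [Gnj], the integral of [f] at row n+1 equals that at every later row, hence that
    of a late predictive mean. The left side does not depend on how late, so the limit gives an
    exact equality. *)
Lemma cid_directing (f : Xs -> R) n j (K : Omega -> R) :
  continuous f -> (forall x, 0 <= f x <= 1) ->
  measurable_wrt (Gnj G X n j) K -> (forall w, 0 <= K w <= 1) ->
  \int[P]_w (K w * f (X n.+1 j w)) = \int[P]_w (K w * kernel_mean (alpha j) f w).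
Proof.
move=> cf f01 mK K01; have mf := measurable_continuous_borel cf.
have bf m := mbounded_test m j mf f01.
have bl := mbounded_limit j mf f01.
have [V [mV V01 VE Vl]] := predictive_means j cf f01.
have bV m : mbounded (V m).
  by apply: mbounded01 => //; exact: (measurable_wrt_fun (Gm (n := m))).
have H A : Gnj G X n j A ->
    \int[P]_w (\1_A w * f (X n.+1 j w)) = \int[P]_w (\1_A w * kernel_mean (alpha j) f w).
  move=> GA; have bA : mbounded (\1_A : Omega -> R).
    by apply: mbounded_indic; exact: Gnjm GA.
  apply/eqP; rewrite -subr_eq0 -normr_le0; apply/ler_addgt0Pl => e e0; rewrite addr0.
  have /cvgr0Pnorm_lt/(_ _ e0)[m _ /(_ (n + m).+1)] := Vl.
  rewrite /= -ltnS ltnS leqW ?leq_addl// => /(_ isT)/ltW; apply: le_trans.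
  (* Row [n + m + 2] is predicted at time [n + m + 1], late enough because [A] lies in [G n.+1]. *)
  rewrite (cid_shift m.+1 mf f01 GA) addnS VE; last first.
    by apply: (Gle _ (GnjS GA)); rewrite addnS ltnS leq_addr.
  rewrite addnS -RintegralTB; [|exact: mboundedM|exact: mboundedM].
  have bD := mboundedB (bV (n + m).+1) bl.
  rewrite [leRHS]ger0_norm ?Rintegral_ge0//.
  apply: le_norm_RintegralT.
  - by apply: mboundedB; exact: mboundedM.
  - exact: mbounded_norm.
  - move=> w; rewrite -mulrBr normrM indicE; case: (w \in A).
      by rewrite normr1 mul1r.
    by rewrite normr0 mul0r.
have mid := measurable_fun_sub_sigma (@sGnj n j) (@Gnjm n j).
have mK' : measurable_fun setT (K : g_sigma_algebraType (Gnj G X n j) -> R).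
  exact/(measurable_wrtP (@sGnj n j)).
pose TH := g_sigma_algebraType (Gnj G X n j).
(* From events to the weight [K]: on [Omega] with the sigma-algebra [Gnj], [K] is its own mean under
   the Dirac kernel, and the functions integrated against it take the role of weights in
   [eq_kernel_mean]. *)
pose k (w : Omega) : probability TH R := \d_(w : TH).
have kK w : kernel_mean k K w = K w.
  exact: (@kernel_mean_dirac _ _ Omega _ TH (fun w => w) K w mK').
have E (phi : Omega -> R) :
    \int[P]_w (K w * phi w) = \int[P]_w (phi w * kernel_mean k K w).
  by apply: eq_Rintegral => w _; rewrite kK mulrC.
have mk (B : set TH) : measurable B -> measurable_fun setT (fun w => k w B).
  by move=> mB; exact: (@measurable_dirac_kernel R _ Omega _ TH (fun w => w)).
rewrite !E; apply: (@eq_kernel_mean _ _ _ _ TH P k k) => //.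
  by move=> w; exact: limit_01.
move=> B; rewrite (measurable_sub_sigmaE (@sGnj n j)) => GB.
have kE w : fine (k w B) = \1_B w by [].
under eq_Rintegral do rewrite kE mulrC.
by under [RHS]eq_Rintegral do rewrite kE mulrC; exact: H.
Qed.

(* The entry with the largest row index is replaced by its limit, using the
   other entries of the same row only through [Gnj]; the limit is then replaced
   by the [G n]-measurable predictive mean, which is absorbed by the weight. *)
Lemma cid_products (s : seq (nat * I)) (f : nat -> I -> Xs -> R)
    (W : nat -> Omega -> R) :
  uniq s -> (forall m i, continuous (f m i)) -> (forall m i x, 0 <= f m i x <= 1) ->
  (forall n, measurable_wrt (G n) (W n)) -> (forall n w, 0 <= W n w <= 1) ->
  (fun n => \int[P]_w (W n w * \prod_(p <- s) f p.1 p.2 (X (n + p.1).+1 p.2 w)) -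
     \int[P]_w (W n w * \prod_(p <- s) kernel_mean (alpha p.2) (f p.1 p.2) w))
   @ \oo --> (0 : R).
Proof.
move=> + cf f01; move: {-1}(size s) (erefl (size s)) => k sk.
have mf m i := measurable_continuous_borel (cf m i).
have bf n m m' i : mbounded (fun w => f m i (X n.+1 m' w)) by exact: mbounded_test.
have bl m i : mbounded (kernel_mean (alpha i) (f m i)) by exact: mbounded_limit.
have l01 m i w : 0 <= kernel_mean (alpha i) (f m i) w <= 1 by exact: limit_01.
elim: k s sk W => [|k IHk] s sk W us mW W01.
  have /size0nil -> := sk.
  rewrite (_ : (fun n => _) = cst 0); first exact: cvg_cst.
  apply/funext => n; apply/eqP; rewrite subr_eq0; apply/eqP.
  by apply: eq_Rintegral => w _; rewrite !big_nil.
have [p0 p0s p0max] : exists2 p0, p0 \in s & forall p, p \in s -> (p.1 <= p0.1)%N.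
  have [q qs] : exists q, q \in s by case: (s) sk => // q ? _; exists q; rewrite mem_head.
  have exP : exists n, n \in map fst s by exists q.1; exact: map_f.
  have ub n : n \in map fst s -> (n <= \max_(p <- s) p.1)%N.
    by move=> /mapP[p ps ->]; exact: (@leq_bigmax_seq _ _ xpredT fst).
  case: (ex_maxnP exP ub) => n /mapP[p0 p0s ->] mx; exists p0 => // p ps.
  by apply: mx; exact: map_f.
pose s' := rem p0 s; have ps' : perm_eq s (p0 :: s') by exact: perm_to_rem.
have us' : uniq s' by exact: rem_uniq.
have sk' : k = size s' by rewrite size_rem// sk.
have s'P p : p \in s' -> p \in s /\ p != p0.
  by move=> ps; have := mem_rem_uniq p0 us; move/(_ p); rewrite -/s' ps !inE => /esym/andP[].
(* The mean is taken at time [n], not at the row of [p0]: [W n * V n] must again be [G n]-measurable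
   to serve as a weight. *)
have [V [mV V01 _ Vl]] := predictive_means p0.2 (cf p0.1 p0.2) (f01 p0.1 p0.2).
pose F n w := \prod_(p <- s') f p.1 p.2 (X (n + p.1).+1 p.2 w).
pose A w := \prod_(p <- s') kernel_mean (alpha p.2) (f p.1 p.2) w.
pose a0 := kernel_mean (alpha p0.2) (f p0.1 p0.2).
pose D n := \int[P]_w `|V n w - a0 w|.
have bW n : mbounded (W n) by apply: mbounded01 => //; exact: (measurable_wrt_fun (@Gm n)).
have bV n : mbounded (V n) by apply: mbounded01 => //; exact: (measurable_wrt_fun (@Gm n)).
have bF n : mbounded (F n) by exact: mbounded_prod.
have bA : mbounded A by exact: mbounded_prod.
have ba0 : mbounded a0 by exact: bl.
have prod01 (g : nat * I -> Omega -> R) w : (forall p w, 0 <= g p w <= 1) ->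
    0 <= \prod_(p <- s') g p w <= 1.
  move=> g01; elim: s' {us' sk' ps' s'P F A bF bA} => [|p t IHt].
    by rewrite big_nil ler01 lexx.
  rewrite big_cons; have /andP[g0 g1] := g01 p w; have /andP[t0 t1] := IHt.
  by rewrite mulr_ge0//= -[leRHS]mul1r ler_pM.
have F01 n w : 0 <= F n w <= 1.
  by apply: (prod01 (fun p w => f p.1 p.2 (X (n + p.1).+1 p.2 w))) => *; exact: f01.
have A01 w : 0 <= A w <= 1.
  by apply: (prod01 (fun p => kernel_mean (alpha p.2) (f p.1 p.2))) => *; exact: l01.
have mul01 (x y : R) : 0 <= x <= 1 -> 0 <= y <= 1 -> 0 <= x * y <= 1.
  by move=> /andP[x0 x1] /andP[y0 y1]; rewrite mulr_ge0//= -[leRHS]mul1r ler_pM.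
have WFm n : measurable_wrt (Gnj G X (n + p0.1) p0.2) (fun w => W n w * F n w).
  apply/(measurable_wrtP (@sGnj _ _)).
  pose TH := g_sigma_algebraType (Gnj G X (n + p0.1) p0.2).
  have GG m : (m <= n + p0.1)%N -> G m `<=` Gnj G X (n + p0.1) p0.2.
    by move=> mn B GB; apply: sub_sigma_algebra; left; exact: Gle GB.
  have mW' : measurable_fun setT (W n : TH -> R).
    apply/(measurable_wrtP (@sGnj _ _)) => B mB.
    by apply: (GG n); rewrite ?leq_addr//; exact: mW.
  apply: (@measurable_funM _ TH _ setT (W n) (F n)) => //.
  apply: (@measurable_prod _ TH) => p ps.
  have [pins pp0] := s'P _ ps.
  apply: (@measurableT_comp _ _ _ TH (borel Xs) R (f p.1 p.2) _ (X (n + p.1).+1 p.2)) => //.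
  apply/(measurable_wrtP (@sGnj _ _)) => B mB.
  (* An entry in the row of [p0] differs from [p0], hence lies in another column and is a generator
     of [Gnj]; an entry of an earlier row belongs to the past. *)
  have := p0max _ pins; rewrite leq_eqVlt => /orP[/eqP p1|p1].
    apply: sub_sigma_algebra; right; exists p.2, B; split => //; last by rewrite p1.
    apply: contra pp0 => /eqP p2.
    by rewrite (surjective_pairing p) (surjective_pairing p0) p1 p2.
  by apply: (GG (n + p.1).+1); [rewrite ltn_add2l|exact: XG].
have e1 n : \int[P]_w (W n w * \prod_(p <- s) f p.1 p.2 (X (n + p.1).+1 p.2 w)) =
    \int[P]_w (W n w * F n w * a0 w).
  rewrite -(@cid_directing _ (n + p0.1) p0.2 (fun w => W n w * F n w))//; last first.
    by move=> w; exact: mul01.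
  by apply: eq_Rintegral => w _; rewrite (perm_big _ ps') big_cons/= mulrCA mulrC.
have e2 n : \int[P]_w (W n w * \prod_(p <- s) kernel_mean (alpha p.2) (f p.1 p.2) w) =
    \int[P]_w (W n w * A w * a0 w).
  by apply: eq_Rintegral => w _; rewrite (perm_big _ ps') big_cons/= mulrCA mulrC.
(* Exchanging [a0] for [V n] costs at most [D n] whatever the remaining factor; this is done on the
   entries [F n] and, backwards, on their limits [A]. *)
have close n (B : Omega -> R) : mbounded B -> (forall w, 0 <= B w <= 1) ->
    `|\int[P]_w (W n w * B w * a0 w) - \int[P]_w (W n w * V n w * B w)| <= D n.
  move=> bB B01; rewrite -RintegralTB; last 2 first.
  - by apply: mboundedM => //; exact: mboundedM.
  - by apply: mboundedM => //; exact: mboundedM.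
  apply: le_norm_RintegralT.
  - by apply: mboundedB; apply: mboundedM => //; exact: mboundedM.
  - by apply: mbounded_norm; exact: mboundedB.
  move=> w; rewrite [W n w * V n w * _]mulrAC -mulrBr normrM distrC -[leRHS]mul1r ler_pM//.
  by have /andP[? ?] := mul01 _ _ (W01 n w) (B01 w); rewrite ger0_norm.
have {}IHk := IHk s' (esym sk') (fun n w => W n w * V n w) us'.
have mWV n : measurable_wrt (G n) (fun w => W n w * V n w).
  apply/(measurable_wrtP (sG n)).
  apply: (@measurable_funM _ (g_sigma_algebraType (G n)) _ setT (W n) (V n));
    exact/(measurable_wrtP (sG n)).
have {}IHk := IHk mWV (fun n w => mul01 _ _ (W01 n w) (V01 n w)).
apply/cvgr0Pnorm_le => e e0.
(* One third for the induction hypothesis, one for each use of [close]. *)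
have e3 : 0 < e / 3 by rewrite divr_gt0.
have /cvgr0Pnorm_le/(_ _ e3) I3 := IHk.
have /cvgr0Pnorm_le/(_ _ e3) D3 := Vl.
near=> n.
have Dn : D n <= e / 3.
  rewrite -[leLHS]ger0_norm; first by near: n.
  by apply: Rintegral_ge0.
have In : `|\int[P]_w (W n w * V n w * F n w) - \int[P]_w (W n w * V n w * A w)| <= e / 3.
  by near: n.
rewrite e1 e2; have := close n _ (bF n) (F01 n); have := close n _ bA A01.
move: In; rewrite !ler_norml => /andP[? ?] /andP[? ?] /andP[? ?].
by apply/andP; split; lra.
Unshelve. all: by end_near. Qed.

End cid_arrays.

(** * Convergence in distribution from test functions *)

Lemma ptws_cvg (K : Type) (V : topologicalType) (F : set_system {ptws K -> V})
    (f : {ptws K -> V}) : Filter F ->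
  (forall k, (fun g : K -> V => g k) @ F --> f k) -> F --> f.
Proof.
move=> FF Ff; apply/cvg_sup => k U [V0] [[W] oW <-] Wf WU.
by apply: filterS WU _; apply: Ff; exact: open_nbhs_nbhs.
Qed.

Section test_functions.
Context {R : realType} {I : countType} {Xs : completePseudoMetricType R}.
Local Notation array := {ptws nat -> {ptws I -> Xs}}.

(** Entries are not repeated since each factor is to be replaced by its own alpha-integral, which
    would be wrong for a repeated entry. The constant [c] admits 0 as a test function. *)
Definition is_test (h : array -> R) : Prop :=
  exists c (s : seq (nat * I)) (f : nat -> I -> Xs -> R),
  [/\ 0 <= c <= 1, uniq s, forall m i, continuous (f m i),
      forall m i x, 0 <= f m i x <= 1 &
      forall z, h z = c * \prod_(p <- s) f p.1 p.2 (z p.1 p.2)].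

Lemma prod_seq_01 (J : Type) (s : seq J) (f : J -> R) :
  (forall j, 0 <= f j <= 1) -> 0 <= \prod_(j <- s) f j <= 1.
Proof.
move=> f01; elim: s => [|j s /andP[s0 s1]]; first by rewrite big_nil ler01 lexx.
rewrite big_cons; have /andP[j0 j1] := f01 j.
by rewrite mulr_ge0//= -[leRHS]mul1r ler_pM.
Qed.

Lemma is_test_01 h : is_test h -> forall z, 0 <= h z <= 1.
Proof.
move=> [c [s [f [/andP[c0 c1] _ _ f01 hE]]]] z; rewrite hE.
have /andP[p0 p1] := @prod_seq_01 _ s (fun p => f p.1 p.2 (z p.1 p.2))
  (fun p => f01 _ _ _).
by rewrite mulr_ge0//= -[leRHS]mul1r ler_pM.
Qed.

Lemma is_test_cst c : 0 <= c <= 1 -> is_test (fun=> c).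
Proof.
move=> c01; exists c, [::], (fun _ _ => cst 1); split => //.
- by move=> m i; exact: cst_continuous.
- by move=> m i x; rewrite ler01 lexx.
- by move=> z; rewrite big_nil mulr1.
Qed.

(** Common entries have to be merged to keep the list free of repetitions; [cut] pads each family
    with 1 outside its own list. *)
Lemma is_testM h h' : is_test h -> is_test h' -> is_test (fun z => h z * h' z).
Proof.
move=> [c [s [f [/andP[c0 c1] us cf f01 hE]]]].
move=> [c' [s' [f' [/andP[c'0 c'1] us' cf' f'01 hE']]]].
pose cut (t : seq (nat * I)) (g : nat -> I -> Xs -> R) m i x : R :=
  if (m, i) \in t then g m i x else 1.
have cut01 t g m i x : (forall m i x, 0 <= g m i x <= 1) -> 0 <= cut t g m i x <= 1.
  by move=> g01; rewrite /cut; case: ifP; rewrite ?ler01 ?lexx.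
have cutc t g m i : (forall m i, continuous (g m i)) -> continuous (cut t g m i).
  by move=> cg; rewrite /cut; case: ((m, i) \in t); [exact: cg|exact: cst_continuous].
have cutE (t : seq (nat * I)) (g : nat -> I -> Xs -> R) (z : array) :
    uniq t -> {subset t <= s ++ s'} -> \prod_(p <- t) g p.1 p.2 (z p.1 p.2) =
    \prod_(p <- undup (s ++ s')) cut t g p.1 p.2 (z p.1 p.2).
  move=> ut ts; rewrite [RHS](eq_bigr (fun p =>
    if p \in t then g p.1 p.2 (z p.1 p.2) else 1)); last by move=> [].
  rewrite -big_mkcond /= -[RHS]big_filter; apply: perm_big; apply: uniq_perm => //.
    by rewrite filter_uniq// undup_uniq.
  move=> p; rewrite mem_filter mem_undup.
  by case: (boolP (p \in t)) => // /ts ->.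
exists (c * c'), (undup (s ++ s')), (fun m i x => cut s f m i x * cut s' f' m i x).
split.
- by rewrite mulr_ge0//= -[leRHS]mul1r ler_pM.
- exact: undup_uniq.
- by move=> m i x; apply: continuousM; [exact: cutc|exact: cutc].
- move=> m i x; have /andP[a0 a1] := cut01 s f m i x f01.
  have /andP[b0 b1] := cut01 s' f' m i x f'01.
  by rewrite mulr_ge0//= -[leRHS]mul1r ler_pM.
move=> z; rewrite hE hE' big_split/= mulrACA; congr (_ * (_ * _)).
  by apply: cutE => // p ps; rewrite mem_cat ps.
by apply: cutE => // p ps; rewrite mem_cat ps orbT.
Qed.

Lemma mbounded_is_test d (Omega : measurableType d) (Y : Omega -> array) h :
  (forall m i, measurable_fun setT (fun w => Y w m i : borel Xs)) ->
  is_test h -> mbounded (fun w => h (Y w)).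
Proof.
move=> mY [c [s [f [_ _ cf f01 hE]]]]; under eq_fun do rewrite hE.
apply: mboundedM; first exact: mbounded_cst.
apply: (@mbounded_prod _ _ _ _ s (fun p w => f p.1 p.2 (Y w p.1 p.2))) => p.
apply: (@mbounded_comp _ _ _ (borel Xs)); last exact: mY.
by apply: mbounded01; [exact: measurable_continuous_borel|exact: f01].
Qed.

Variable x : nat -> Xs.
Hypothesis dx : forall y (e : R), 0 < e -> exists n, ball y e (x n).

Local Notation eps k := (k.+1%:R^-1 : R).

(** The doubled radius leaves a gap of [eps k] between the two sets, so they are uniformly separated
    and a Urysohn function exists. *)
Definition bump (j k : nat) : Xs -> R :=
  Urysohn (~` ball (x j) (eps k + eps k)) (ball (x j) (eps k)).

Lemma bump_continuous j k : continuous (bump j k).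
Proof. exact: Urysohn_continuous. Qed.

Lemma bump_01 j k y : 0 <= bump j k y <= 1.
Proof.
have : range (bump j k) (bump j k y) by exists y.
by move=> /Urysohn_range; rewrite /= in_itv.
Qed.

Let bump_sep j k :
  uniform_separator (~` ball (x j) (eps k + eps k)) (ball (x j) (eps k)).
Proof.
apply: uniform_separatorW.
exists [set yz : Xs * Xs | ball yz.1 (eps k) yz.2].
  by apply: (@entourage_ball _ Xs (PosNum (_ : 0 < eps k))); rewrite invr_gt0.
apply/seteqP; split => // -[y z] [[/= yj zj] yz]; apply: yj.
by apply: ball_triangle zj _; exact: ball_sym.
Qed.

Lemma bump_eq1 j k y : ball (x j) (eps k) y -> bump j k y = 1.
Proof. by move=> yj; apply: (Urysohn_sub1 (bump_sep j k)); exists y. Qed.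

Lemma bump_supp j k y : bump j k y != 0 -> ball (x j) (eps k + eps k) y.
Proof.
move=> /eqP by0; apply: contrapT => yj; apply: by0.
by apply: (Urysohn_sub0 (bump_sep j k)); exists y.
Qed.

Definition positions (n : nat) : seq (nat * I) := undup (pmap pickle_inv (iota 0 n)).

Lemma mem_positions n p : (p \in positions n) = (pickle p < n)%N.
Proof.
rewrite mem_undup mem_pmap; apply/mapP/idP => [[k]|pn].
  rewrite mem_iota add0n => /andP[_ kn] pk.
  by have := @pickle_invK (nat * I)%type k; rewrite -pk /= => ->.
by exists (pickle p); rewrite ?mem_iota// pickleK_inv.
Qed.

(** A bump is indexed by countable data, namely a number of entries, a list of centres and a scale,
    so that all of them can be enumerated. *)
Definition array_bump (b : nat * seq nat * nat) (z : array) : R :=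
  \prod_(p <- positions b.1.1) bump (nth 0%N b.1.2 (pickle p)) b.2 (z p.1 p.2).

Lemma is_test_array_bump b : is_test (array_bump b).
Proof.
exists 1, (positions b.1.1), (fun m i => bump (nth 0%N b.1.2 (pickle (m, i))) b.2).
split; rewrite ?ler01 ?lexx ?undup_uniq//.
- by move=> m i; exact: bump_continuous.
- by move=> m i y; exact: bump_01.
- by move=> z; rewrite mul1r; apply: eq_bigr => -[].
Qed.

Variable g : array -> R.
Hypothesis cg : forall z : array, g y @[y --> z] --> g z.

(* If no cylinder around [z] stayed in the superlevel set, one could choose a
   sequence converging pointwise to [z] outside of it. *)
Lemma superlevel_cylinder t z : t < g z -> exists n k, forall y : array,
  (forall p, p \in positions n -> ball (z p.1 p.2) (eps k) (y p.1 p.2)) -> t < g y.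
Proof.
move=> tz; apply: contrapT => nz.
have H n : exists y : array,
    (forall p, p \in positions n -> ball (z p.1 p.2) (eps n) (y p.1 p.2)) /\ ~ (t < g y).
  apply: contrapT => ny; apply: nz; exists n, n => y yz.
  by apply: contrapT => nt; apply: ny; exists y.
have [y yP] := choice H.
have yz : y n @[n --> \oo] --> z.
  apply: ptws_cvg => m; apply: ptws_cvg => i; apply/cvg_ballP => e e0.
  have [k _ ke] := near_infty_natSinv_lt (PosNum e0).
  exists (maxn k (pickle (m, i)).+1) => // n /=; rewrite geq_max => /andP[kn pn].
  have [/(_ (m, i)) + _] := yP n; rewrite mem_positions => /(_ pn).
  by apply: le_ball; exact/ltW/(ke n).
have /(cvg_comp _ _ yz) : g y' @[y' --> z] --> g z by exact: cg.
move=> /cvgr_gt /(_ _ tz) [n _ /(_ n (leqnn n))] /= tg.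
by have [_] := yP n; apply.
Qed.

(** Bumps supported in the superlevel set are kept and the others replaced by 0. Those kept reach 1
    around each point of the set, so the products of the complements [1 - b n] decrease to the
    indicator of its complement. *)
Lemma superlevel_tests t : exists b : nat -> array -> R,
  [/\ forall n, is_test (b n), forall n z, b n z != 0 -> t < g z &
      forall z, t < g z -> exists n, b n z = 1].
Proof.
pose ok b := `[< forall z, array_bump b z != 0 -> t < g z >].
exists (fun n => if unpickle n is Some b then
  if ok b then array_bump b else fun=> 0 else fun=> 0); split.
- move=> n; case: (unpickle n) => [b|]; last by apply: is_test_cst; rewrite lexx ler01.
  by case: ifP => _; [exact: is_test_array_bump|apply: is_test_cst; rewrite lexx ler01].
- move=> n z; case: (unpickle n) => [b|]; last by rewrite eqxx.
  by case: ifP => [/asboolP|_]; [exact|rewrite eqxx].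
move=> z tz; have [n [k nk]] := superlevel_cylinder tz.
(* One [eps l] from [z] to the chosen centre and two for the support of the bump. *)
have e3 : 0 < eps k / 3 by rewrite divr_gt0 ?invr_gt0.
have [l _ /(_ l (leqnn l)) /= le] := near_infty_natSinv_lt (PosNum e3).
pose near q := if @unpickle (nat * I)%type q is Some p then
  xget 0%N [set j | ball (z p.1 p.2) (eps l) (x j)] else 0%N.
have nearP p : ball (z p.1 p.2) (eps l) (x (near (pickle p))).
  rewrite /near pickleK; case: xgetP => [j _ //|nj].
  have [|j zj] := dx (z p.1 p.2) (e := eps l); first by rewrite invr_gt0.
  by case: (nj j).
pose b := (n, mkseq near n, l).
have bE y : array_bump b y = \prod_(p <- positions n) bump (near (pickle p)) l (y p.1 p.2).
  rewrite /array_bump big_seq [RHS]big_seq; apply: eq_bigr => p.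
  by rewrite mem_positions => pn; rewrite nth_mkseq.
exists (pickle b); rewrite pickleK.
suff -> : ok b by rewrite bE big1// => p _; apply: bump_eq1; exact/ball_sym/nearP.
apply/asboolP => y; rewrite bE => by0; apply: nk => p pn.
have {}by0 : bump (near (pickle p)) l (y p.1 p.2) != 0.
  by apply: contra_neq by0 => by0; rewrite (big_rem p)//= by0 mul0r.
apply: (le_ball _ (ball_triangle (nearP p) (bump_supp by0))).
by move: (eps l) (eps k) le => a c ?; lra.
Qed.

(** Continuity for the product topology is turned into measurability coordinate by coordinate: a
    superlevel set is a countable union of sets where a test function is nonzero. *)
Lemma measurable_ptws_continuous d (Omega : measurableType d) (Y : Omega -> array) :
  (forall m i, measurable_fun setT (fun w => Y w m i : borel Xs)) ->
  measurable_fun setT (fun w => g (Y w)).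
Proof.
move=> mY; apply: (measurability _ (RGenOInfty.measurableE R)) => _ [_ [t ->] <-].
have [b [tb b0 b1]] := superlevel_tests t.
rewrite setTI (_ : _ @^-1` _ = [set w | exists n, [set w | b n (Y w) != 0] w]).
  apply: measurable_exists => n; have [mb _] := mbounded_is_test mY (tb n).
  have := mb measurableT (~` [set 0]) (measurableC (measurable_set1 0)).
  rewrite setTI (_ : _ @^-1` _ = [set w | b n (Y w) != 0])//.
  by apply/seteqP; split => w /= /eqP.
apply/seteqP; split => w /=; rewrite in_itv/= andbT.
  by move=> /b1[n bn]; exists n; rewrite bn oner_neq0.
by move=> [n /b0].
Qed.

End test_functions.

Lemma cvg_sum_seq (R : realType) (J : Type) (s : seq J) (f : nat -> J -> R) (l : J -> R) :
  (forall j, f n j @[n --> \oo] --> l j) ->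
  (fun n => \sum_(j <- s) f n j) @ \oo --> \sum_(j <- s) l j.
Proof.
move=> fl; elim: s => [|j s IHs].
  by rewrite big_nil; under eq_fun do rewrite big_nil; exact: cvg_cst.
by rewrite big_cons; under eq_fun do rewrite big_cons; exact: cvgD.
Qed.

Section test_convergence.
Context {R : realType} {I : countType} {Xs : completePseudoMetricType R}.
Local Notation array := {ptws nat -> {ptws I -> Xs}}.
Context {d d'} {Omega : measurableType d} {Omega' : measurableType d'}.
Variables (P : probability Omega R) (P' : probability Omega' R).
Variables (Y : nat -> Omega -> array) (Z : Omega' -> array).
Hypothesis pX : polish Xs.
Hypothesis mY : forall n m i, measurable_fun setT (fun w => Y n w m i : borel Xs).
Hypothesis mZ : forall m i, measurable_fun setT (fun w => Z w m i : borel Xs).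
Hypothesis test_cvg : forall h, is_test h ->
  (fun n => \int[P]_w h (Y n w)) @ \oo --> \int[P']_w h (Z w).

(* Expanding the product gives a linear combination of products of test
   functions, which are test functions. *)
Let cotest_cvg (b : nat -> array -> R) J h : (forall j, is_test (b j)) -> is_test h ->
  (fun n => \int[P]_w (h (Y n w) * \prod_(j < J) (1 - b j (Y n w)))) @ \oo -->
  \int[P']_w (h (Z w) * \prod_(j < J) (1 - b j (Z w))).
Proof.
move=> tb; elim: J h => [|J IHJ] h th.
  have E0 d0 (T : measurableType d0) (Q : probability T R) (V : T -> array) :
      \int[Q]_w (h (V w) * \prod_(j < 0) (1 - b j (V w))) = \int[Q]_w h (V w).
    by apply: eq_Rintegral => w _; rewrite big_ord0 mulr1.
  by rewrite E0; under eq_fun do rewrite E0; exact: test_cvg.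
have bp d0 (T : measurableType d0) (V : T -> array) J' :
    (forall m i, measurable_fun setT (fun w => V w m i : borel Xs)) ->
    mbounded (fun w => \prod_(j < J') (1 - b j (V w))).
  move=> mV; apply: (@mbounded_prod _ _ _ _ _ (fun (j : 'I_J') w => 1 - b j (V w))) => j.
  by apply: mboundedB; [exact: mbounded_cst|exact: (mbounded_is_test mV)].
have E d0 (T : measurableType d0) (Q : probability T R) (V : T -> array) :
    (forall m i, measurable_fun setT (fun w => V w m i : borel Xs)) ->
    \int[Q]_w (h (V w) * \prod_(j < J.+1) (1 - b j (V w))) =
    \int[Q]_w (h (V w) * \prod_(j < J) (1 - b j (V w))) -
    \int[Q]_w ((h (V w) * b J (V w)) * \prod_(j < J) (1 - b j (V w))).
  move=> mV; rewrite -RintegralTB.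
  - apply: eq_Rintegral => w _; rewrite big_ord_recr/=.
    by rewrite mulrBr mulr1 mulrBr; congr (_ - _); rewrite -mulrA [X in _ = _ * X]mulrC.
  - by apply: mboundedM; [exact: (mbounded_is_test mV)|exact: bp].
  - apply: mboundedM; last exact: bp.
    by apply: mboundedM; exact: (mbounded_is_test mV).
rewrite E//; under eq_fun do rewrite E//.
by apply: cvgB; [exact: IHJ|apply: (IHJ (fun z => h z * b J z)); exact: is_testM].
Qed.

Let approx (b : nat -> nat -> array -> R) N J (z : array) : R :=
  N.+1%:R^-1 * \sum_(k < N.+1) (1 - \prod_(j < J) (1 - b k j z)).

Let mbounded_approx d0 (T : measurableType d0) (V : T -> array) b N J :
  (forall m i, measurable_fun setT (fun w => V w m i : borel Xs)) ->
  (forall k j, is_test (b k j)) -> mbounded (fun w => approx b N J (V w)).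
Proof.
move=> mV tb; apply: mboundedM; first exact: mbounded_cst.
apply: mbounded_sum => k _; apply: mboundedB; first exact: mbounded_cst.
apply: (@mbounded_prod _ _ _ _ _ (fun (j : 'I_J) w => 1 - b k j (V w))) => j.
by apply: mboundedB; [exact: mbounded_cst|exact: (mbounded_is_test mV)].
Qed.

Let approx_cvg b N J : (forall k j, is_test (b k j)) ->
  (fun n => \int[P]_w approx b N J (Y n w)) @ \oo --> \int[P']_w approx b N J (Z w).
Proof.
move=> tb.
have bp d0 (T : measurableType d0) (V : T -> array) k :
    (forall m i, measurable_fun setT (fun w => V w m i : borel Xs)) ->
    mbounded (fun w => \prod_(j < J) (1 - b k j (V w))).
  move=> mV; apply: (@mbounded_prod _ _ _ _ _ (fun (j : 'I_J) w => 1 - b k j (V w))) => j.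
  by apply: mboundedB; [exact: mbounded_cst|exact: (mbounded_is_test mV)].
have E d0 (T : measurableType d0) (Q : probability T R) (V : T -> array) :
    (forall m i, measurable_fun setT (fun w => V w m i : borel Xs)) ->
    \int[Q]_w approx b N J (V w) = N.+1%:R^-1 * \sum_(k < N.+1)
      (1 - \int[Q]_w (1 * \prod_(j < J) (1 - b k j (V w)))).
  move=> mV.
  have b1 k : mbounded (fun w => 1 - \prod_(j < J) (1 - b k j (V w))).
    by apply: mboundedB; [exact: mbounded_cst|exact: bp].
  rewrite /approx RintegralTZl; last by apply: mbounded_sum => k _.
  rewrite (@RintegralT_sum _ _ _ Q _ _ (fun (k : 'I_N.+1) w =>
    1 - \prod_(j < J) (1 - b k j (V w))))//.
  congr (_ * _); apply: eq_bigr => k _.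
  rewrite RintegralTB; [|exact: mbounded_cst|exact: bp].
  rewrite RintegralT_cst; congr (_ - _).
  by apply: eq_Rintegral => w _; rewrite mul1r.
rewrite E//; under eq_fun do rewrite E//.
apply: cvgM; first exact: cvg_cst.
apply: (@cvg_sum_seq _ _ _ (fun n (k : 'I_N.+1) =>
  1 - \int[P]_w (1 * \prod_(j < J) (1 - b k j (Y n w))))) => k.
apply: cvgB; first exact: cvg_cst.
by apply: (cotest_cvg _ _ (h := fun=> 1)) => //; apply: is_test_cst; rewrite ler01 lexx.
Qed.

(** The approximation stays below [g] pointwise, so for [Y n] it loses nothing and no uniformity in
    [n] is required. The three thirds of [e] pay for the layers, for the truncation at [J] bumps,
    and for the convergence in [n]. *)
Lemma expectation_lower_bound (g : array -> R) e :
  (forall z : array, g y @[y --> z] --> g z) -> (forall z, 0 <= g z <= 1) -> 0 < e ->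
  \forall n \near \oo, \int[P']_w g (Z w) - e <= \int[P]_w g (Y n w).
Proof.
move=> cg g01 e0; have [x dx] := polish_dense_seq pX.
have e3 : 0 < e / 3 by rewrite divr_gt0.
have [N _ /(_ N (leqnn N)) /= Ne] := near_infty_natSinv_lt (PosNum e3).
have N0 : 0 < N.+1%:R :> R by [].
have [b bP] := choice (fun k : nat => superlevel_tests dx cg (k.+1%:R / N.+1%:R)).
have tb k j : is_test (b k j) by have [] := bP k.
have layerE k z : layer N g k z <-> k.+1%:R / N.+1%:R < g z.
  by rewrite /layer/= ltr_pdivrMr// mulrC.
have prod01 k J z : 0 <= \prod_(j < J) (1 - b k j z) <= 1.
  apply: (@prod_seq_01 R 'I_J _ (fun j => 1 - b k j z)) => j.
  by have /andP[? ?] := is_test_01 (tb k j) z; apply/andP; split; lra.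
have leU J z : approx b N J z <= g z.
  have /andP[+ _] := layer_cake_bounds N (g01 z); apply: le_trans.
  rewrite /approx /layer_cake ler_pM2l ?invr_gt0//; apply: ler_sum => k _.
  have /andP[p0 p1] := prod01 k J z.
  rewrite indicE; have [|nk] := boolP (z \in layer N g k); first by rewrite /=; lra.
  rewrite big1 ?subrr// => j _; have [-> |bn] := eqVneq (b k j z) 0; first by rewrite subr0.
  have [_ /(_ _ _ bn) + _] := bP k; move/layerE => zk.
  by move: nk; rewrite notin_setE.
have Ucvg z : approx b N J z @[J --> \oo] --> layer_cake N g z.
  rewrite /approx /layer_cake; apply: cvgM; first exact: cvg_cst.
  apply: (@cvg_sum_seq _ _ _ (fun J (k : 'I_N.+1) =>
    1 - \prod_(j < J) (1 - b k j z))) => k; rewrite indicE.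
  have [|nk] := boolP (z \in layer N g k); last first.
    rewrite (_ : (fun J => _) = cst 0); first exact: cvg_cst.
    apply/funext => J; rewrite big1 ?subrr// => j _.
    have [->|bn] := eqVneq (b k j z) 0; first by rewrite subr0.
    have [_ /(_ _ _ bn) + _] := bP k; move/layerE => zk.
    by move: nk; rewrite notin_setE.
  (* A single factor [1 - b k j] equal to 0 kills the product for all [J > j], so the limit is
     attained. *)
  rewrite inE => /layerE zk; have [_ _ /(_ _ zk)[j bj]] := bP k.
  apply: cvg_near_cst; exists j.+1 => // J /= jJ.
  by rewrite (bigD1 (Ordinal jJ))//= bj subrr mul0r subr0.
have U0 J z : 0 <= approx b N J z.
  rewrite mulr_ge0// sumr_ge0// => k _; rewrite subr_ge0.
  by have /andP[] := prod01 k J z.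
have mg : measurable_fun setT (fun w => g (Z w)) by exact: (measurable_ptws_continuous dx cg).
have bg : mbounded (fun w => g (Z w)) by exact: mbounded01.
have bgY n : mbounded (fun w => g (Y n w)).
  by apply: mbounded01 => //; exact: (measurable_ptws_continuous dx cg).
have bU J := mbounded_approx N J mZ tb.
have bC : mbounded (fun w => layer_cake N g (Z w)).
  apply: mboundedM; first exact: mbounded_cst.
  apply: (@mbounded_sum _ _ _ _ _ xpredT
    (fun (k : 'I_N.+1) w => \1_(layer N g k) (Z w))) => k _.
  by apply: (@mbounded_indic _ _ R (layer N (fun w => g (Z w)) k)); exact: measurable_layer.
have ICcvg : (fun J => \int[P']_w approx b N J (Z w)) @ \oo -->
    \int[P']_w layer_cake N g (Z w).
  apply: fine_cvg; rewrite -/(Rintegral _ _ _) EFin_RintegralT//.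
  apply: (@dominated_cvg _ _ _ _ _ measurableT _ _ (cst 1%E)) => //.
  - by move=> J; apply/measurable_EFinP; have [] := bU J.
  - by move=> w _; apply: cvg_EFin; [exact: nearW|exact: Ucvg].
  - exact: (mbounded_integrable P' (mbounded_cst 1)).
  - move=> J w _; rewrite lee_fin ger0_norm//; apply: le_trans (leU J _) _.
    by have /andP[] := g01 (Z w).
have IC : \int[P']_w g (Z w) - e / 3 <= \int[P']_w layer_cake N g (Z w).
  rewrite lerBlDr -(RintegralT_cst P' (e / 3)) -RintegralTD//; last exact: mbounded_cst.
  apply: le_RintegralT => //; first by apply: mboundedD => //; exact: mbounded_cst.
  move=> w; have /andP[_ gl] := layer_cake_bounds N (g01 (Z w)).
  by apply: (le_trans gl); rewrite lerD2l ltW.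
have /cvgr_ge/(_ (\int[P']_w layer_cake N g (Z w) - e / 3)) := ICcvg.
case=> [|J _ /(_ J (leqnn J)) /= HJ]; first by rewrite ltrBlDr ltrDl.
have /cvgr_ge/(_ (\int[P']_w approx b N J (Z w) - e / 3)) := @approx_cvg b N J tb.
case=> [|n0 _ Hn0]; first by rewrite ltrBlDr ltrDl.
exists n0 => // n /Hn0 /= Hn.
have : \int[P]_w approx b N J (Y n w) <= \int[P]_w g (Y n w).
  by apply: le_RintegralT => //; exact: mbounded_approx.
by lra.
Qed.

Lemma cvg_expectations (g : array -> R) :
  (forall z : array, g y @[y --> z] --> g z) -> (forall z, 0 <= g z <= 1) ->
  (fun n => \int[P]_w g (Y n w)) @ \oo --> \int[P']_w g (Z w).
Proof.
move=> cg g01; have [x dx] := polish_dense_seq pX.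
have bg d0 (T : measurableType d0) (V : T -> array) :
    (forall m i, measurable_fun setT (fun w => V w m i : borel Xs)) ->
    mbounded (fun w => g (V w)).
  by move=> mV; apply: mbounded01 => //; exact: (measurable_ptws_continuous dx cg).
apply/cvgrPdist_le => e e0.
have c1g (z : array) : 1 - g y @[y --> z] --> 1 - g z.
  apply: (@cvg_comp _ _ _ g (fun r => 1 - r) _ _ _ (cg z)).
  by apply: cvgB; [exact: cvg_cst|exact: cvg_id].
have g'01 z : 0 <= 1 - g z <= 1.
  by have /andP[? ?] := g01 z; apply/andP; split; lra.
near=> n.
have L : \int[P']_w g (Z w) - e <= \int[P]_w g (Y n w).
  by near: n; exact: expectation_lower_bound.
have U : \int[P']_w (1 - g (Z w)) - e <= \int[P]_w (1 - g (Y n w)).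
  by near: n; exact: (expectation_lower_bound c1g).
move: U; rewrite !RintegralTB; [|exact: mbounded_cst|exact: bg|exact: mbounded_cst|exact: bg].
by rewrite !RintegralT_cst => U; rewrite ler_norml; apply/andP; split; lra.
Unshelve. all: by end_near. Qed.

Lemma cvg_in_distribution_of_tests : cvg_in_distribution P Y P' Z.
Proof.
move=> g cg [M gM]; have [x dx] := polish_dense_seq pX.
(* Positive whatever [M] is, so that dividing by [c] rescales [g] into the unit interval. *)
have M0 : 0 < `|M| + 1 by rewrite ltr_wpDl.
have gM' z : - (`|M| + 1) <= g z <= `|M| + 1.
  by rewrite -ler_norml (le_trans (gM z))// (le_trans (ler_norm M))// lerDl ler01.
pose c := (`|M| + 1) * 2.
have c0 : 0 < c by rewrite mulr_gt0.
pose g' z := (g z + (`|M| + 1)) / c.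
have gE z : g z = c * g' z - (`|M| + 1) by rewrite /g' mulrCA divff ?gt_eqF// mulr1 addrK.
have cg' (z : array) : g' y @[y --> z] --> g' z.
  apply: (@cvg_comp _ _ _ g (fun r => (r + (`|M| + 1)) / c) _ _ _ (cg z)).
  apply: cvgM; last exact: cvg_cst.
  by apply: cvgD; [exact: cvg_id|exact: cvg_cst].
have g'01 z : 0 <= g' z <= 1.
  have /andP[? ?] := gM' z; rewrite /g' ler_pdivrMr// mul1r divr_ge0 ?(ltW c0)//=.
    by rewrite /c; lra.
  by lra.
have bg' d0 (T : measurableType d0) (V : T -> array) :
    (forall m i, measurable_fun setT (fun w => V w m i : borel Xs)) ->
    mbounded (fun w => g' (V w)).
  by move=> mV; apply: mbounded01 => //; exact: (measurable_ptws_continuous dx cg').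
have E d0 (T : measurableType d0) (Q : probability T R) (V : T -> array) :
    (forall m i, measurable_fun setT (fun w => V w m i : borel Xs)) ->
    (\int[Q]_w (g (V w))%:E)%E = (c * \int[Q]_w g' (V w) - (`|M| + 1))%:E.
  move=> mV; rewrite -EFin_RintegralT; last first.
    under eq_fun do rewrite gE; apply: mboundedB; last exact: mbounded_cst.
    by apply: mboundedM; [exact: mbounded_cst|exact: bg'].
  under eq_Rintegral do rewrite gE.
  rewrite RintegralTB; [|by apply: mboundedM; [exact: mbounded_cst|exact: bg']|exact: mbounded_cst].
  by rewrite RintegralT_cst RintegralTZl//; exact: bg'.
rewrite E//; under eq_fun do rewrite E//.
apply: cvg_EFin; first exact: nearW.
apply: cvgB; last exact: cvg_cst.
by apply: cvgM; [exact: cvg_cst|exact: cvg_expectations].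
Qed.

End test_convergence.

(** * The limit array *)

Section limit_array.
Context {R : realType} {d} {Omega : measurableType d}.
Context {I : countType} {Xs : completePseudoMetricType R}.
Variable alpha : I -> Omega -> probability (borel Xs) R.
Hypothesis malpha : forall i (B : set (borel Xs)), measurable B ->
  measurable_fun [set: Omega] (fun w => alpha i w B).

Context {d'} {Omega' : measurableType d'} (P' : probability Omega' R).
Variables (pi : Omega' -> Omega) (Z : nat -> I -> Omega' -> borel Xs).
Hypothesis mpi : measurable_fun setT pi.
Hypothesis mZ : forall m i, measurable_fun setT (Z m i).

Hypothesis jointZ : forall (s : seq (nat * I)) (B : nat -> I -> set (borel Xs)) A,
  uniq s -> (forall m i, measurable (B m i)) -> measurable A ->
  P' (pi @^-1` A `&` [set w | forall p, p \in s -> B p.1 p.2 (Z p.1 p.2 w)]) =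
  (\int[P']_(w in pi @^-1` A) (\prod_(p <- s) fine (alpha p.2 (pi w) (B p.1 p.2)))%:E)%E.

Local Notation hits s B := [set w | forall p, p \in s -> B p.1 p.2 (Z p.1 p.2 w)].

Let measurable_hits (s : seq (nat * I)) (B : nat -> I -> set (borel Xs)) :
  (forall m i, measurable (B m i)) -> measurable (hits s B).
Proof.
move=> mB; rewrite (_ : hits s B =
    \big[setI/setT]_(p <- s) (Z p.1 p.2 @^-1` B p.1 p.2)).
  apply: bigsetI_measurable => p _; rewrite -[X in measurable X]setTI.
  exact: mZ.
by rewrite -bigcap_seq.
Qed.

Let malpha' i (B : set (borel Xs)) : measurable B ->
  measurable_fun setT (fun w => alpha i (pi w) B).
Proof. by move=> mB; exact: (measurableT_comp (malpha i mB) mpi). Qed.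

Let mbounded_alpha i (B : set (borel Xs)) : measurable B ->
  mbounded (fun w => fine (alpha i (pi w) B)).
Proof.
move=> mB; apply: mbounded01.
  by apply: (measurableT_comp (fine_measurable measurableT)); exact: malpha'.
move=> w; rewrite fine_ge0//= -lee_fin fineK ?probability_le1//.
exact: fin_num_measure.
Qed.

Let alpha_01 i (B : set (borel Xs)) w : measurable B -> 0 <= fine (alpha i (pi w) B) <= 1.
Proof.
move=> mB; rewrite fine_ge0//= -lee_fin fineK ?probability_le1//.
exact: fin_num_measure.
Qed.

Let mbounded_prod_alpha (s : seq (nat * I)) (B : nat -> I -> set (borel Xs)) :
  (forall m i, measurable (B m i)) ->
  mbounded (fun w => \prod_(p <- s) fine (alpha p.2 (pi w) (B p.1 p.2))).
Proof.
move=> mB; apply: (@mbounded_prod _ _ _ _ s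
  (fun p w => fine (alpha p.2 (pi w) (B p.1 p.2)))) => p.
exact: mbounded_alpha.
Qed.

Let hits_law s B : uniq s -> (forall m i, measurable (B m i)) ->
  P' (hits s B) = (\int[P']_w (\prod_(p <- s) fine (alpha p.2 (pi w) (B p.1 p.2)))%:E)%E.
Proof.
move=> us mB; have := jointZ us mB (@measurableT _ Omega).
by rewrite preimage_setT setTI.
Qed.

(** [jointZ] conditions on all of [Omega]; the product of masses is already measurable for the
    directing measures, and the events these generate are preimages under [pi]. *)
Lemma limit_array_cond_indep : cond_indep_laws P' Z (fun i w => alpha i (pi w)).
Proof.
move=> s B us mB; pose H := sigma_rm (fun i w => alpha i (pi w)).
have sH : sigma_algebra setT H by exact: smallest_sigma_algebra.
have Hpi A : H A -> exists2 A0, measurable A0 & A = pi @^-1` A0.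
  move: A; apply: smallest_sub => [|_ [i [C [D [mC mD ->]]]]].
    split.
    - by exists set0; rewrite ?preimage_set0.
    - move=> _ [A mA ->]; exists (~` A); first exact: measurableC.
      by rewrite setTD preimage_setC.
    - move=> F FA; have {}FA n : exists A0, measurable A0 /\ F n = pi @^-1` A0.
        by have [A0 ? ?] := FA n; exists A0.
      have [A AP] := choice FA; exists (\bigcup_n A n).
        by apply: bigcupT_measurable => n; have [] := AP n.
      by rewrite preimage_bigcup; apply: eq_bigcupr => n _; have [] := AP n.
  exists ((fun w => alpha i w C) @^-1` D) => //.
  by rewrite -[X in measurable X]setTI; exact: malpha.
split.
- apply/(measurable_wrtP sH).
  apply: (@measurable_prod _ (g_sigma_algebraType H)) => p _.
  apply: (measurableT_comp (fine_measurable measurableT)) => _ D mD.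
  rewrite setTI (measurable_sub_sigmaE sH); apply: sub_sigma_algebra.
  by exists p.2, (B p.1 p.2), D.
- exact: mbounded_integrable (mbounded_prod_alpha s mB).
move=> A /Hpi[A0 mA0 ->].
rewrite -jointZ// integral_indic//; first by rewrite setIC.
- by rewrite -[X in measurable X]setTI; exact: mpi.
- exact: measurable_hits.
Qed.

(** The law of an entry given [Omega] depends on its column only, so moving entries within columns
    leaves the product of masses unchanged; cylinders then determine the law. *)
Lemma limit_array_exchangeable : partially_exchangeable P' Z.
Proof.
move=> sg sgP A HA.
pose arr := g_sigma_algebraType [set A : set (nat -> I -> Xs) |
  exists m i (B : set (borel Xs)), measurable B /\ A = [set z | B (z m i)]].
have marr (V : nat -> I -> Omega' -> borel Xs) : (forall m i, measurable_fun setT (V m i)) ->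
    measurable_fun setT ((fun w m i => V m i w) : Omega' -> arr).
  move=> mV; apply: (@measurability _ _ _ arr setT _ [set A : set (nat -> I -> Xs) |
    exists m i (B : set (borel Xs)), measurable B /\ A = [set z | B (z m i)]]) => //.
  by move=> _ [_ [m [i [B [mB ->]]]] <-]; exact: mV.
have [m1 m1E] := image_measure (marr _ mZ) P'.
have [m2 m2E] := image_measure (marr _ (fun m i => mZ (sg i m) i)) P'.
rewrite -[LHS]m1E -[RHS]m2E.
pose cyl (c : seq (nat * I) * (nat -> I -> set (borel Xs))) : set arr :=
  [set z | forall p, p \in c.1 -> c.2 p.1 p.2 (z p.1 p.2)].
pose C := [set D | exists c, [/\ forall m i, measurable (c.2 m i) & D = cyl c]].
have Cm : C `<=` measurable.
  move=> _ [[s B] [/= mB ->]].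
  rewrite (_ : cyl _ = \big[setI/setT]_(p <- s) [set z : arr | B p.1 p.2 (z p.1 p.2)]).
    apply: bigsetI_measurable => p _; apply: sub_sigma_algebra.
    by exists p.1, p.2, (B p.1 p.2).
  by rewrite -bigcap_seq.
have CI : setI_closed C.
  move=> _ _ [[s1 B1] [/= mB1 ->]] [[s2 B2] [/= mB2 ->]].
  exists (s1 ++ s2, fun m i => (if (m, i) \in s1 then B1 m i else setT) `&`
    (if (m, i) \in s2 then B2 m i else setT)); split.
    by move=> m i /=; apply: measurableI; case: ifP.
  apply/seteqP; split => z /=.
    move=> [z1 z2] [m i] /= _; split.
      by case: ifP => // mi; exact: (z1 (m, i)).
    by case: ifP => // mi; exact: (z2 (m, i)).
  move=> zz; split => -[m i] mi.
    by have := zz (m, i); rewrite /= mem_cat mi /= => /(_ isT)[].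
  by have := zz (m, i); rewrite /= mem_cat mi orbT /= => /(_ isT)[].
have C1 : C setT.
  exists ([::], fun _ _ => setT); split; first by move=> m i /=.
  by apply/seteqP; split.
apply: (@g_sigma_algebra_measure_unique _ _ arr C Cm (fun=> setT)) => //.
- by rewrite bigcup_const//; exists 0%N.
- move=> _ [[s B] [/= mB ->]]; rewrite m1E m2E.
  have undupE (V : nat -> I -> Omega' -> borel Xs) : (fun w m i => V m i w) @^-1` cyl (s, B) =
      [set w | forall p, p \in undup s -> B p.1 p.2 (V p.1 p.2 w)].
    by apply/seteqP; split => w wB p ps; apply: wB; rewrite /= ?mem_undup// -mem_undup.
  rewrite !undupE.
  have sgV i : exists t, cancel (sg i) t by have [[t ?] _] := sgP i; exists t.
  have [tau tauK] := choice sgV.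
  (* The permutations are moved from the array to the cylinder: entry [(sg i m, i)] receives the
     event of [(m, i)], found through the inverse [tau]. *)
  pose s' := [seq (sg p.2 p.1, p.2) | p <- undup s].
  pose B' m i := B (tau i m) i.
  have -> : [set w | forall p, p \in undup s -> B p.1 p.2 (Z (sg p.2 p.1) p.2 w)] = hits s' B'.
    apply/seteqP; split => w wB p.
      by move=> /mapP[q qs ->]; rewrite /B' /= tauK; exact: wB.
    move=> ps; have := wB (sg p.2 p.1, p.2); rewrite /B' /= tauK; apply.
    by apply/mapP; exists p.
  have us' : uniq s'.
    rewrite map_inj_in_uniq ?undup_uniq// => -[m i] [m' i'] _ _ /= [+ ii'].
    by rewrite ii' => /(congr1 (tau i')); rewrite !tauK => ->.
  have mB' m i : measurable (B' m i) by exact: mB.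
  apply: (etrans (hits_law (undup_uniq s) mB)); apply/esym.
  apply: (etrans (hits_law us' mB')); apply/esym.
  apply: eq_integral => w _; congr EFin; rewrite big_map; apply: eq_bigr => p _.
  by rewrite /B' /= tauK.
- by move=> k; rewrite m1E preimage_setT -ge0_fin_numE// fin_num_measure.
- move: HA; apply: smallest_sub; first exact: smallest_sigma_algebra.
  move=> _ [m [i [B [mB ->]]]]; apply: sub_sigma_algebra.
  exists ([:: (m, i)], fun _ _ => B); split => //.
  apply/seteqP; split => z /=.
    by move=> Bz p; rewrite inE => /eqP ->.
  by move=> /(_ (m, i)); rewrite inE eqxx; exact.
Qed.

(* Indicator functions are replaced by test functions one coordinate at a time. *)
Lemma limit_array_products (s s' : seq (nat * I)) (f : nat -> I -> Xs -> R)
    (B : nat -> I -> set (borel Xs)) :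
  uniq (s ++ s') -> (forall m i, continuous (f m i)) ->
  (forall m i x, 0 <= f m i x <= 1) -> (forall m i, measurable (B m i)) ->
  \int[P']_w (\prod_(p <- s) f p.1 p.2 (Z p.1 p.2 w) * \1_(hits s' B) w) =
  \int[P']_w (\prod_(p <- s) kernel_mean (alpha p.2) (f p.1 p.2) (pi w) *
              \prod_(p <- s') fine (alpha p.2 (pi w) (B p.1 p.2))).
Proof.
move=> + cf f01; have mf m i := measurable_continuous_borel (cf m i).
have bfZ m i : mbounded (fun w => f m i (Z m i w)).
  by apply: (@mbounded_comp _ _ _ (borel Xs)); [exact: mbounded01|exact: mZ].
have bl m i : mbounded (kernel_mean (fun w => alpha i (pi w)) (f m i)).
  by apply: mbounded_kernel_mean => //; exact: malpha'.
have l01 m i w : 0 <= kernel_mean (alpha i) (f m i) w <= 1.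
  by apply: kernel_mean_01 => //; exact: mbounded01.
elim: s s' B => [|p0 s IHs] s' B uss' mB.
  under eq_Rintegral do rewrite big_nil mul1r.
  under [RHS]eq_Rintegral do rewrite big_nil mul1r.
  rewrite RintegralT_indic; last exact: measurable_hits.
  by rewrite hits_law.
have mul01 (x y : R) : 0 <= x <= 1 -> 0 <= y <= 1 -> 0 <= x * y <= 1.
  by move=> /andP[x0 x1] /andP[y0 y1]; rewrite mulr_ge0//= -[leRHS]mul1r ler_pM.
have i01 (D : set Omega') w : 0 <= (\1_D w : R) <= 1.
  by rewrite indicE; case: (w \in D); rewrite /= lexx ler01.
have [p0s p0s' uss] : [/\ p0 \notin s, p0 \notin s' & uniq (s ++ s')].
  by move: uss'; rewrite /= mem_cat negb_or => /andP[/andP[]].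
transitivity (\int[P']_w (\prod_(p <- s) f p.1 p.2 (Z p.1 p.2 w) * \1_(hits s' B) w *
    kernel_mean (fun w => \d_(Z p0.1 p0.2 w)) (f p0.1 p0.2) w)).
  by apply: eq_Rintegral => w _; rewrite big_cons kernel_mean_dirac// -mulrA mulrC.
transitivity (\int[P']_w (\prod_(p <- s) kernel_mean (alpha p.2) (f p.1 p.2) (pi w) *
    \prod_(p <- s') fine (alpha p.2 (pi w) (B p.1 p.2)) *
    kernel_mean (fun w => alpha p0.2 (pi w)) (f p0.1 p0.2) w)); last first.
  by apply: eq_Rintegral => w _; rewrite big_cons mulrC mulrA.
apply: (@eq_kernel_mean _ _ _ _ (borel Xs)) => //.
- by move=> D mD; apply: measurable_dirac_kernel.
- by move=> D mD; exact: malpha'.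
- apply: mboundedM; first exact: (@mbounded_prod _ _ _ _ s (fun p w => f p.1 p.2 (Z p.1 p.2 w))).
  by apply: mbounded_indic; exact: measurable_hits.
- move=> w; apply: mul01 => //.
  exact: (@prod_seq_01 _ _ s (fun p => f p.1 p.2 (Z p.1 p.2 w))).
- apply: mboundedM; last exact: mbounded_prod_alpha.
  apply: (@mbounded_prod _ _ _ _ s
    (fun p w => kernel_mean (alpha p.2) (f p.1 p.2) (pi w))) => p.
  exact: bl.
- move=> w; apply: mul01.
    exact: (@prod_seq_01 _ _ s (fun p => kernel_mean (alpha p.2) (f p.1 p.2) (pi w))).
  apply: (@prod_seq_01 _ _ s' (fun p => fine (alpha p.2 (pi w) (B p.1 p.2)))) => p.
  exact: alpha_01.
(* Only an event [D] on [p0] is left to treat: [p0] moves to the second list, where the induction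
   hypothesis applies. *)
move=> D mD; pose B' m i := if (m, i) == p0 then D else B m i.
have B'0 : B' p0.1 p0.2 = D by rewrite /B' -surjective_pairing eqxx.
have B'E p : p \in s' -> B' p.1 p.2 = B p.1 p.2.
  rewrite /B' -surjective_pairing => ps; case: eqP => // pp0.
  by move: p0s'; rewrite -pp0 ps.
have us2 : uniq (s ++ p0 :: s') by rewrite -cat1s uniq_catCA.
have H := IHs (p0 :: s') B' us2.
transitivity (\int[P']_w
    (\prod_(p <- s) f p.1 p.2 (Z p.1 p.2 w) * \1_(hits (p0 :: s') B') w)).
  apply: eq_Rintegral => w _; rewrite -mulrA; congr (_ * _).
  rewrite (_ : fine _ = \1_D (Z p0.1 p0.2 w))// !indicE -natrM mulnb.
  congr ((_ : bool)%:R).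
  apply/andP/idP; rewrite !inE.
    move=> [ws' wD] p; rewrite inE => /orP[/eqP ->|ps]; first by rewrite B'0.
    by rewrite B'E//; exact: ws'.
  move=> wB; split; last by have := wB p0 (mem_head _ _); rewrite B'0.
  by move=> p ps; rewrite -B'E//; apply: wB; rewrite inE ps orbT.
rewrite H; last by move=> m i; rewrite /B'; case: ifP.
apply: eq_Rintegral => w _; rewrite big_cons B'0 -mulrA; congr (_ * _).
rewrite mulrC; congr (_ * _); rewrite big_seq [RHS]big_seq.
by apply: eq_bigr => p ps; rewrite B'E.
Qed.

End limit_array.

(** * The extension of the probability space by a uniform variable *)

Section product_with_uniform.
Context {R : realType} {d} {Omega : measurableType d} (P : probability Omega R).

Definition prod_uniform : set (Omega * measurableTypeR R) -> \bar R :=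
  (P \x uniform_prob (@ltr01 R))%E.

HB.instance Definition _ := Measure.on prod_uniform.

Lemma prod_uniformE A : measurable A ->
  prod_uniform A = (\int[P]_w uniform_prob (@ltr01 R) [set u | A (w, u)])%E.
Proof.
move=> mA; rewrite /prod_uniform /product_measure1; apply: eq_integral => w _ /=.
by congr (uniform_prob _ _); apply/seteqP; split => u; rewrite /xsection/= inE.
Qed.

Let prod_uniform_setT : prod_uniform setT = 1%E.
Proof.
rewrite prod_uniformE//; under eq_integral do rewrite probability_setT.
rewrite integral_cst// mul1e; exact: probability_setT.
Qed.

HB.instance Definition _ := Measure_isProbability.Build _ _ _ prod_uniform prod_uniform_setT.

End product_with_uniform.

Section randomized_arrays.
Context {R : realType} {d} {Omega : measurableType d} (P : probability Omega R).
Context {I : countType} {d'} {T : measurableType d'}.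
Local Notation Omega' := (Omega * measurableTypeR R)%type.

Lemma prod_uniform_fst (A : set Omega) : measurable A ->
  prod_uniform P ((@fst Omega (measurableTypeR R)) @^-1` A) = P A.
Proof.
move=> mA; rewrite prod_uniformE; last first.
  by rewrite -[X in measurable X]setTI; exact: measurable_fst.
transitivity (\int[P]_w (\1_A w)%:E)%E; last by rewrite integral_indic// setIT.
apply: eq_integral => w _.
rewrite indicE; have [Aw|nAw] := boolP (w \in A).
  rewrite (_ : [set u | _] = setT); first exact: probability_setT.
  by apply/seteqP; split => // u _; rewrite /= -inE.
rewrite (_ : [set u | _] = set0) ?measure0//; apply/seteqP; split => // u /= Aw.
by move: nAw; rewrite notin_setE.
Qed.

Lemma integral_prod_uniform_fst (A : set Omega) (F : Omega -> \bar R) :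
  measurable A -> measurable_fun setT F -> (forall w, (0 <= F w)%E) ->
  (\int[prod_uniform P]_(w in fst @^-1` A) F w.1 = \int[P]_(w in A) F w)%E.
Proof.
move=> mA mF F0.
have mfst : measurable_fun setT (@fst Omega (measurableTypeR R)) by exact: measurable_fst.
have := @ge0_integral_pushforward _ _ _ _ R _ mfst (prod_uniform P) A F mA.
move=> /= <- //; last exact: measurable_funTS.
by apply: eq_measure_integral => C mC _; exact: prod_uniform_fst.
Qed.

(** [randomization] gives the law for each fixed [w]; integrating it over [A] gives the joint law
    with [Omega]. *)
Lemma randomized_array (alpha : I -> Omega -> probability T R) : coded T ->
  (forall i B, measurable B -> measurable_fun setT (fun w => alpha i w B)) ->
  exists2 Z : nat -> I -> Omega' -> T,
    forall m i, measurable_fun setT (Z m i) &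
    forall (s : seq (nat * I)) (B : nat -> I -> set T) A,
      uniq s -> (forall m i, measurable (B m i)) -> measurable A ->
      prod_uniform P (fst @^-1` A `&` [set w | forall p, p \in s -> B p.1 p.2 (Z p.1 p.2 w)]) =
      (\int[prod_uniform P]_(w in fst @^-1` A)
         (\prod_(p <- s) fine (alpha p.2 w.1 (B p.1 p.2)))%:E)%E.
Proof.
move=> cT malpha.
(* Numbers coding no entry get a Dirac mass; the array reads only the codes of entries. *)
pose mu q w : probability T R :=
  if @unpickle (nat * I)%type q is Some p then alpha p.2 w else \d_point.
have mmu q B : measurable B -> measurable_fun setT (fun w => mu q w B).
  by rewrite /mu; case: (unpickle q) => [p|] mB; [exact: malpha|exact: measurable_cst].
have [Zq mZq Zlaw] := randomization cT mmu.
exists (fun m i => Zq (pickle (m, i))) => // s B A us mB mA.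
have mfst : measurable_fun setT (@fst Omega (measurableTypeR R)) by exact: measurable_fst.
pose F w : R := \prod_(p <- s) fine (alpha p.2 w (B p.1 p.2)).
have F0 w : 0 <= F w by apply: prodr_ge0 => p _; exact/fine_ge0/measure_ge0.
have mF : measurable_fun setT F.
  apply: measurable_prod => p _.
  by apply: (measurableT_comp (fine_measurable measurableT)); exact: malpha.
transitivity (\int[P]_(w in A) (F w)%:E)%E; last first.
  rewrite -(@integral_prod_uniform_fst A (EFin \o F))//.
  exact/measurable_EFinP.
rewrite prod_uniformE; last first.
  apply: measurableI; first by rewrite -[X in measurable X]setTI; exact: mfst.
  rewrite (_ : [set w | _] =
      \big[setI/setT]_(p <- s) (Zq (pickle p) @^-1` B p.1 p.2)).
    apply: bigsetI_measurable => p _; rewrite -[X in measurable X]setTI.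
    exact: mZq.
  rewrite -bigcap_seq; apply/seteqP; split => w wB p ps.
    by have := wB p ps; rewrite -surjective_pairing.
  by rewrite -surjective_pairing; exact: wB.
rewrite [RHS]integral_mkcond; apply: eq_integral => w _; rewrite patchE.
have [Aw|nAw] := boolP (w \in A); last first.
  rewrite (_ : [set u | _] = set0) ?measure0//; apply/seteqP; split => // u [/= Aw _].
  by move: nAw; rewrite notin_setE.
pose Bq q := if @unpickle (nat * I)%type q is Some p then B p.1 p.2 else setT.
have mBq q : measurable (Bq q) by rewrite /Bq; case: (unpickle q).
have usq : uniq (map pickle s) by rewrite map_inj_uniq//; exact: (pcan_inj pickleK).
have := Zlaw w _ Bq usq mBq; rewrite big_map /F.
rewrite (eq_bigr (fun p => fine (alpha p.2 w (B p.1 p.2)))); last first.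
  by move=> p _; rewrite /mu /Bq pickleK.
move=> <-; congr (uniform_prob _ _); apply/seteqP; split => u /=.
  move=> [_ sB] _ /mapP[p ps ->]; rewrite /Bq pickleK.
  by have := sB p ps; rewrite -surjective_pairing.
move=> sB; split; first by rewrite inE in Aw.
move=> p ps; have := sB _ (map_f pickle ps); rewrite /Bq pickleK.
by rewrite -surjective_pairing.
Qed.

End randomized_arrays.

Unset Implicit Arguments.

Theorem mainTheorem8 (R : realType) (d : measure_display)
  (Omega : measurableType d) (P : probability Omega R)
  (Xs : completePseudoMetricType R) (I : countType)
  (G : nat -> set_system Omega) (X : nat -> I -> Omega -> borel Xs)
  (alpha : I -> Omega -> probability (borel Xs) R) :
  polish Xs ->
  partially_cid P G X ->
  directing_measures P G X alpha ->
  exists (d' : measure_display) (Omega' : measurableType d')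
         (P' : probability Omega' R) (pi : Omega' -> Omega)
         (Z : nat -> I -> Omega' -> borel Xs),
    [/\ measurable_fun [set: Omega'] pi /\
        (forall A : set Omega, measurable A -> P' (pi @^-1` A) = P A),
        (forall m i, measurable_fun [set: Omega'] (Z m i)),
        partially_exchangeable P' Z,
        cond_indep_laws P' Z (fun i w' => alpha i (pi w')) &
        cvg_in_distribution P (fun n w m i => X (n + m.+1)%N i w)
                            P' (fun w' m i => Z m i w')].
Proof.
move=> pX cidX dirX; have [malpha _] := dirX.
have [Z mZ jointZ] := randomized_array P (polish_coded pX) malpha.
have mfst : measurable_fun setT (@fst Omega (measurableTypeR R)) by exact: measurable_fst.
exists _, (Omega * measurableTypeR R)%type, (prod_uniform P), fst, Z; split.
- by split => // A mA; exact: prod_uniform_fst.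
- exact: mZ.
- exact: (limit_array_exchangeable mZ jointZ).
- exact: (limit_array_cond_indep malpha mfst mZ jointZ).
apply: cvg_in_distribution_of_tests => //.
  by move=> n m i; rewrite addnS; exact: (measurable_array cidX).
move=> h [c [s [f [c01 us cf f01 hE]]]].
pose K w := \prod_(p <- s) kernel_mean (alpha p.2) (f p.1 p.2) w.
have mf m i := measurable_continuous_borel (cf m i).
have bK : mbounded K.
  apply: (@mbounded_prod _ _ _ _ s (fun p => kernel_mean (alpha p.2) (f p.1 p.2))) => p.
  exact: (mbounded_limit dirX).
have bX n : mbounded (fun w => \prod_(p <- s) f p.1 p.2 (X (n + p.1).+1 p.2 w)).
  apply: (@mbounded_prod _ _ _ _ s (fun p w => f p.1 p.2 (X (n + p.1).+1 p.2 w))) => p.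
  exact: (mbounded_test cidX).
have bZ : mbounded (fun w => \prod_(p <- s) f p.1 p.2 (Z p.1 p.2 w)).
  apply: (@mbounded_prod _ _ _ _ s (fun p w => f p.1 p.2 (Z p.1 p.2 w))) => p.
  by apply: (@mbounded_comp _ _ _ (borel Xs)); [exact: mbounded01|exact: mZ].
have -> : \int[prod_uniform P]_w h (fun m i => Z m i w) = c * \int[P]_w K w.
  under eq_Rintegral do rewrite hE.
  rewrite RintegralTZl//; congr (c * _).
  (* Every entry carries a test function, so the list of indicators is empty. *)
  have us0 : uniq (s ++ [::]) by rewrite cats0.
  have := limit_array_products malpha mfst mZ jointZ us0 cf f01
    (fun _ _ => @measurableT _ (borel Xs)).
  move=> H; transitivity (\int[prod_uniform P]_w (K w.1)); last first.
    rewrite /Rintegral; congr fine.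
    have [mK _] := bK; rewrite -(@integral_prod_uniform_fst _ _ _ P setT (EFin \o K))//.
      exact/measurable_EFinP.
    move=> w; rewrite lee_fin; apply: prodr_ge0 => p _.
    by have /andP[] := limit_01 alpha p.2 (mf p.1 p.2) (f01 p.1 p.2) w.
  transitivity (\int[prod_uniform P]_w (\prod_(p <- s) f p.1 p.2 (Z p.1 p.2 w) *
      \1_[set w | forall p : nat * I, p \in [::] -> setT (Z p.1 p.2 w)] w)).
    by apply: eq_Rintegral => w _; rewrite indicE mem_set ?mulr1.
  by rewrite H; apply: eq_Rintegral => w _; rewrite big_nil mulr1.
(* The weights serve the induction inside [cid_products]; it is started with the constant 1. *)
have mW n : measurable_wrt (G n) (fun _ : Omega => 1 : R).
  have [[sG _ _] _ _] := cidX; apply/(measurable_wrtP (sG n)).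
  exact: measurable_cst.
have W01 (n : nat) (w : Omega) : 0 <= (1 : R) <= 1 by rewrite ler01 lexx.
have L := cid_products cidX dirX us cf f01 mW W01.
rewrite (_ : (fun n => _) = (fun n => c * (
    (\int[P]_w (1 * \prod_(p <- s) f p.1 p.2 (X (n + p.1).+1 p.2 w)) -
     \int[P]_w (1 * \prod_(p <- s) kernel_mean (alpha p.2) (f p.1 p.2) w)) +
    \int[P]_w K w))).
  apply: cvgM; first exact: cvg_cst.
  by rewrite -[X in _ --> X]add0r; apply: cvgD => //; exact: cvg_cst.
apply/funext => n.
have -> : \int[P]_w (1 * \prod_(p <- s) kernel_mean (alpha p.2) (f p.1 p.2) w) = \int[P]_w K w.
  by apply: eq_Rintegral => w _; rewrite mul1r.
rewrite subrK -RintegralTZl; last first.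
  by apply: mboundedM; [exact: mbounded_cst|exact: bX].
apply: eq_Rintegral => w _; rewrite hE mul1r; congr (_ * _).
by apply: eq_bigr => p _; rewrite addnS.
Qed.
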